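(* Let $0<r<1$ be fixed and let $T:\mathrm{Hol}(\mathbb{D})\to\mathrm{Hol}(\mathbb{D})$ be a linear continuous operator such that for all $f\in\mathrm{Hol}(\mathbb{D})$, \[ \|Tf\|_{\infty,r}=\|f\|_{\infty,r},\qquad\text{where } \|f\|_{\infty,r}=\sup_{|z|\le r}|f(z)|. \] Then there exist a map $B_1$, which is either constant or a finite Blaschke product, and $\beta\in\mathbb{C}$ with $|\beta|=1$, such that for all $f\in\mathrm{Hol}(\mathbb{D})$ and $z\in\mathbb{D}$, \[ (Tf)(z)=B_1(z/r)\,f(\beta z). \]
   Context: $\mathbb{D}$ is the open unit disc and $\mathrm{Hol}(\mathbb{D})$ the space of holomorphic functions on $\mathbb{D}$ with the topology of uniform convergence on compact subsets. A finite Blaschke product is a function of the form $z\mapsto c\prod_{j=1}^{n}\frac{z-a_j}{1-\overline{a_j}z}$ with $|c|=1$, $n\ge1$ and $a_1,\dots,a_n\in\mathbb{D}$. *)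

(* Defs.v *)
From HB Require Import structures.
From mathcomp Require Import all_boot all_order all_algebra.
From mathcomp Require Import all_classical all_reals all_analysis.
From mathcomp Require Import complex.
Set Implicit Arguments. Unset Strict Implicit. Unset Printing Implicit Defensive.
Import Order.TTheory GRing.Theory Num.Theory.
Import numFieldNormedType.Exports.
Local Open Scope ring_scope.
Local Open Scope classical_set_scope.

Definition cabs (R : realType) (z : R[i]) : R := Normc.normc z.

Definition disc (R : realType) : set R[i] := [set z | cabs z < 1].

Definition Hol (R : realType) (f : R[i] -> R[i]) : Prop :=
  forall z, @disc R z -> derivable (f : R[i]^o -> R[i]^o) z 1.

Definition supnorm_r (R : realType) (r : R) (f : R[i] -> R[i]) : R :=
  sup [set cabs (f z) | z in [set z : R[i] | cabs z <= r]].

(* continuity of T on Hol(D) for the topology of uniform convergence on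
   compact subsets of D (closed seminorm balls form a neighbourhood base) *)
Definition hol_continuous (R : realType) (T : (R[i] -> R[i]) -> (R[i] -> R[i])) : Prop :=
  forall f, Hol f -> forall (K : set (R[i] : numFieldType)), compact K -> K `<=` @disc R ->
  forall eps : R, 0 < eps ->
  exists (L : set (R[i] : numFieldType)) (delta : R),
    [/\ compact L, L `<=` @disc R, 0 < delta &
    forall g, Hol g -> (forall z, L z -> cabs (g z - f z) <= delta) ->
      forall z, K z -> cabs (T g z - T f z) <= eps].

Definition blaschke (R : realType) (c : R[i]) (a : seq R[i]) (z : R[i]) : R[i] :=
  c * \prod_(x <- a) ((z - x) / (1 - x^* * z)).

Definition finite_blaschke (R : realType) (B : R[i] -> R[i]) : Prop :=
  exists (c : R[i]) (a : seq R[i]),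
    [/\ cabs c = 1, (1 <= size a)%N, (forall x, x \in a -> @disc R x) &
        B = blaschke c a].

Definition constant_map (R : realType) (B : R[i] -> R[i]) : Prop :=
  exists c : R[i], B = fun _ => c.

(* Main.v *)
(* Write g_n = T(z^n).  For |l| = 1 the function 1 + z/(r l) + (z/(r l))^n has norm 3,
   so its image has modulus 3 at some z with |z| <= r.  The three summands have modulus
   at most 1, hence agree there: |g_0| = 1, g_1 = r l g_0 and g_n = (r l)^n g_0 at z.
   Different l give different z, so g_{n+1} g_0^n = g_1^{n+1} on the disc by the identity
   theorem.  Applying T to the expansion of 1 / (1 - u/w) and using continuity shows
   |g_1| <= |g_0|, so that phi = g_1 / g_0 is a holomorphic self-map of the disc.

   Taking l = 1 and l = -1 gives points z, z' of modulus at most r that phi sends to r and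
   -r.  Schwarz-Pick says that phi does not increase the pseudo-hyperbolic distance, and r,
   -r are the farthest points of the disc of radius r: this forces z' = -z and |z| = r,
   and the equality case makes phi a rotation.  Then g_n = g_0 (beta z)^n, so
   T f = g_0 f(beta .) for polynomials, hence for all f; and the points z above now
   fill the whole circle, so |g_0| = 1 on |z| = r.  Dividing out the zeros of g_0
   leaves a function without zeros which is unimodular on that circle, a constant.

   The function theory needed rests on Cauchy's formula, obtained from Goursat's bisection
   argument on the square parametrizing the homotopy a + s (rho e^{it} - a); it gives the
   Taylor expansion with remainder and, applied to powers f^m, the maximum principle.
   Identity theorem: if f has zeros a_1, ..., a_m in |z| <= rho, dividing them out through
   Blaschke factors gives |f(z)| <= M k^m with k < 1 independent of m. *)
Require Import Defs.
From HB Require Import structures.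
From mathcomp Require Import all_boot all_order all_algebra.
From mathcomp Require Import all_classical all_reals all_analysis.
From mathcomp Require Import complex ring lra.
Import Order.TTheory GRing.Theory Num.Theory.
Import numFieldNormedType.Exports.
Local Open Scope ring_scope.
Local Open Scope classical_set_scope.
Set Implicit Arguments.
Unset Strict Implicit.

Local Notation "x %:K" := ((x%:C)%C) (at level 1, format "x %:K").

(** * The modulus and epsilon-delta derivatives *)

Section ComplexModulus.
Context {R : realType}.
Implicit Types (x y : R) (z w : R[i]).

Lemma normE z : `|z| = ((cabs z)%:C)%C.
Proof. by []. Qed.

Lemma cabs_ge0 z : 0 <= cabs z.
Proof. by case: z => a b; apply: sqrtr_ge0. Qed.

Lemma cabsM z w : cabs (z * w) = cabs z * cabs w.
Proof. exact: Normc.normcM. Qed.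

Lemma cabsD z w : cabs (z + w) <= cabs z + cabs w.
Proof. exact: (@le_normcD R). Qed.

Lemma cabsN z : cabs (- z) = cabs z.
Proof. exact: (@normcN R). Qed.

Lemma cabsB z w : cabs (z - w) <= cabs z + cabs w.
Proof. by rewrite -(cabsN w) cabsD. Qed.

Lemma cabs0 : cabs (0 : R[i]) = 0.
Proof. exact: Normc.normc0. Qed.

Lemma cabs1 : cabs (1 : R[i]) = 1.
Proof. exact: Normc.normc1. Qed.

Lemma cabsV z : cabs (z^-1) = (cabs z)^-1.
Proof. exact: Normc.normcV. Qed.

Lemma cabsX z n : cabs (z ^+ n) = cabs z ^+ n.
Proof. by elim: n => [|n IH]; rewrite ?expr0 ?cabs1 // !exprS cabsM IH. Qed.

Lemma cabs_eq0 z : (cabs z == 0) = (z == 0).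
Proof.
apply/eqP/eqP => [|->]; last exact: cabs0.
exact: Normc.eq0_normc.
Qed.

Lemma cabs_gt0 z : (0 < cabs z) = (z != 0).
Proof. by rewrite lt_neqAle cabs_ge0 andbT eq_sym cabs_eq0. Qed.

Lemma cabsC x : cabs (x%:C)%C = `|x|.
Proof. by rewrite /cabs /= expr0n /= addr0 sqrtr_sqr. Qed.

Lemma cabs_sqr z : cabs z ^+ 2 = complex.Re z ^+ 2 + complex.Im z ^+ 2.
Proof. by case: z => a b; rewrite sqr_sqrtr // addr_ge0 // sqr_ge0. Qed.

Lemma cabs_conj z : cabs (z^*) = cabs z.
Proof. by case: z => a b; rewrite /cabs /= sqrrN. Qed.

Lemma mulCconj z : z * z^* = ((cabs z ^+ 2)%:C)%C.
Proof. by rewrite -normCK normE -rmorphXn. Qed.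

Lemma conjB z w : (z - w)^* = z^* - w^*.
Proof. exact: rmorphB. Qed.

Lemma conjM z w : (z * w)^* = z^* * w^*.
Proof. exact: rmorphM. Qed.

Lemma conjV z : (z^-1)^* = (z^*)^-1.
Proof. exact: fmorphV. Qed.

Lemma conj_real x : ((x%:C)%C)^* = (x%:C)%C.
Proof. by apply/eqP; rewrite eq_complex /= oppr0 !eqxx. Qed.

Lemma cabs_distC z w : cabs (z - w) = cabs (w - z).
Proof. by rewrite -opprB cabsN. Qed.

Lemma cabs_subl z w : cabs z - cabs w <= cabs (z - w).
Proof. by rewrite lerBlDr -{1}(subrK w z) cabsD. Qed.

Lemma Re_le_cabs z : `|complex.Re z| <= cabs z.
Proof.
rewrite -(@ler_pXn2r _ 2) ?nnegrE ?cabs_ge0 // real_normK ?num_real //.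
by rewrite cabs_sqr lerDl sqr_ge0.
Qed.

Lemma Im_le_cabs z : `|complex.Im z| <= cabs z.
Proof.
rewrite -(@ler_pXn2r _ 2) ?nnegrE ?cabs_ge0 // real_normK ?num_real //.
by rewrite cabs_sqr lerDr sqr_ge0.
Qed.

Lemma cabs_prod (I : Type) (s : seq I) (F : I -> R[i]) :
  cabs (\prod_(i <- s) F i) = \prod_(i <- s) cabs (F i).
Proof.
elim: s => [|i s IH]; first by rewrite !big_nil cabs1.
by rewrite !big_cons cabsM IH.
Qed.

(** Equalities are proved below by bounding a difference by a fixed multiple [M] of an arbitrary
    [e]; the case [e = 1] already shows [0 <= M]. *)
Lemma cabs_small_eq0 z (M : R) :
  (forall e, 0 < e -> cabs z <= M * e) -> z = 0.
Proof.
move=> h; apply/eqP; rewrite -cabs_eq0 eq_le cabs_ge0 andbT.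
have M0 : 0 <= M by have := le_trans (cabs_ge0 z) (h 1 ltr01); rewrite mulr1.
apply/ler_addgt0Pr => e e0; rewrite add0r.
have M1 : 0 < M + 1 by lra.
apply: (le_trans (h (e / (M + 1)) _)); first by rewrite divr_gt0.
by rewrite mulrA ler_pdivrMr // mulrC ler_pM2l // lerDl.
Qed.

End ComplexModulus.

Section Derivatives.
Context {R : realType}.

Definition cderiv (f : R[i] -> R[i]) (z d : R[i]) : Prop :=
  forall e : R, 0 < e -> exists2 dl : R, 0 < dl &
  forall h, cabs h < dl -> cabs (f (z + h) - f z - d * h) <= e * cabs h.

Definition rderiv (f : R -> R[i]) (x : R) (d : R[i]) : Prop :=
  forall e : R, 0 < e -> exists2 dl : R, 0 < dl &
  forall h, `|h| < dl -> cabs (f (x + h) - f x - d * (h%:C)%C) <= e * `|h|.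

Lemma is_derive_eps (K : numFieldType) (f : K^o -> K^o) (z d : K) :
  is_derive (z : K^o) 1 f d <->
  forall e : K, 0 < e -> exists2 dl : K, 0 < dl &
  forall h, `|h| < dl -> `|f (z + h) - f z - d * h| <= e * `|h|.
Proof.
split=> [[df dE] e e0|H].
  have /cvgrPdist_le/(_ e e0) : h^-1 *: ((f \o shift z) (h *: 1) - f z) @[h --> 0^'] --> (d : K^o).
    rewrite -dE; exact: df.
  move=> /= [dl dl0 hdl]; exists dl => // h hh.
  have [->|h0] := eqVneq h 0.
    by rewrite addr0 subrr mulr0 subr0 !normr0 mulr0.
  have := hdl h; rewrite /ball_ /= sub0r normrN => /(_ hh h0).
  rewrite [_ *: 1]mulr1 [_ *: _]/(_ * _) => hle.
  have -> : f (z + h) - f z - d * h = - (d - h^-1 * (f (h + z) - f z)) * h.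
    by rewrite addrC [h + z]addrC; field.
  by rewrite normrM normrN ler_pM2r ?normr_gt0.
have cv : h^-1 *: ((f \o shift z) (h *: 1) - f z) @[h --> 0^'] --> (d : K^o).
  apply/cvgrPdist_le => /= e e0; have [dl dl0 hdl] := H e e0.
  exists dl => // h; rewrite /ball_ /= sub0r normrN => hh h0.
  have := hdl h hh.
  have -> : f (z + h) - f z - d * h = - (d - h^-1 * (f (h + z) - f z)) * h.
    by rewrite addrC [h + z]addrC; field.
  by rewrite normrM normrN ler_pM2r ?normr_gt0 // [_ *: 1]mulr1.
split; first by apply/cvg_ex; exists d.
exact: (cvg_lim _ cv).
Qed.

Lemma cderivP (f : R[i] -> R[i]) (z d : R[i]) :
  is_derive (z : R[i]^o) 1 (f : R[i]^o -> R[i]^o) d <-> cderiv f z d.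
Proof.
rewrite is_derive_eps; split=> H e.
  move=> e0; have [|[d1 d2] dl0 hdl] := H (e%:C)%C; first by rewrite ltcR.
  move: dl0; rewrite ltcE /= => /andP[/eqP d20 d10]; subst d2.
  exists d1 => // h hh; have := hdl h; rewrite !normE !ltcR => /(_ hh).
  by rewrite -rmorphM lecR.
case: e => e1 e2; rewrite ltcE /= => /andP[/eqP e20 e10]; subst e2.
have [dl dl0 hdl] := H _ e10; exists (dl%:C)%C; first by rewrite ltcR.
move=> h; rewrite !normE ltcR => /hdl.
by rewrite -[(e1 +i* 0)%C]/((e1%:C)%C) -rmorphM lecR.
Qed.

Lemma derivable_cderiv (f : R[i] -> R[i]) (z : R[i]) :
  derivable (f : R[i]^o -> R[i]^o) z 1 <-> exists d, cderiv f z d.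
Proof.
split=> [h|[d] /cderivP [] //].
by exists ('D_1 (f : R[i]^o -> R[i]^o) z); apply/cderivP/derivableP.
Qed.

Lemma cderiv_cts f (z d : R[i]) : cderiv f z d ->
  forall e : R, 0 < e -> exists2 dl : R, 0 < dl &
  forall h, cabs h < dl -> cabs (f (z + h) - f z) <= e.
Proof.
move=> H e e0; have [dl dl0 hdl] := H 1 ltr01.
have d0 := cabs_ge0 d.
exists (Num.min dl (e / (1 + cabs d))).
  by rewrite lt_min dl0 divr_gt0 //; lra.
move=> h; rewrite lt_min => /andP[/hdl h1 h2].
have -> : f (z + h) - f z = (f (z + h) - f z - d * h) + d * h by rewrite subrK.
apply: (le_trans (cabsD _ _)); rewrite cabsM.
move: h2; rewrite ltr_pdivlMr; last lra.
by lra.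
Qed.

Lemma rderiv_cts f (x : R) d : rderiv f x d ->
  forall e : R, 0 < e -> exists2 dl : R, 0 < dl &
  forall h, `|h| < dl -> cabs (f (x + h) - f x) <= e.
Proof.
move=> H e e0; have [dl dl0 hdl] := H 1 ltr01.
have d0 := cabs_ge0 d.
exists (Num.min dl (e / (1 + cabs d))).
  by rewrite lt_min dl0 divr_gt0 //; lra.
move=> h; rewrite lt_min => /andP[/hdl h1 h2].
have -> : f (x + h) - f x = (f (x + h) - f x - d * (h%:C)%C) + d * (h%:C)%C.
  by rewrite subrK.
apply: (le_trans (cabsD _ _)); rewrite cabsM cabsC.
move: h2; rewrite ltr_pdivlMr; last lra.
by lra.
Qed.

Lemma rderiv_cst (c : R[i]) x : rderiv (fun=> c) x 0.
Proof.
move=> e e0; exists 1 => // h _.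
by rewrite subrr mul0r subr0 cabs0 mulr_ge0 // ltW.
Qed.

Lemma rderivD f g (x : R) d d' :
  rderiv f x d -> rderiv g x d' -> rderiv (fun t => f t + g t) x (d + d').
Proof.
move=> hf hg e e0; have e2 : 0 < e / 2 by rewrite divr_gt0.
have [d1 d10 h1] := hf _ e2; have [d2 d20 h2] := hg _ e2.
exists (Num.min d1 d2); first by rewrite lt_min d10.
move=> h; rewrite lt_min => /andP[/h1 {}h1 /h2 {}h2].
have -> : f (x + h) + g (x + h) - (f x + g x) - (d + d') * (h%:C)%C =
  (f (x + h) - f x - d * (h%:C)%C) + (g (x + h) - g x - d' * (h%:C)%C) by ring.
by apply: (le_trans (cabsD _ _)); lra.
Qed.

Lemma rderivM f g (x : R) d d' :
  rderiv f x d -> rderiv g x d' ->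
  rderiv (fun t => f t * g t) x (d * g x + f x * d').
Proof.
move=> hf hg e e0.
(* In units of [e / K * |h|], the coefficients of the four error terms below add up to at most
   [K]. *)
set K := 2 + cabs (g x) + cabs (f x) + cabs d'.
have K0 : 0 < K.
  by rewrite /K; move: (cabs_ge0 (g x)) (cabs_ge0 (f x)) (cabs_ge0 d'); lra.
have eK : 0 < e / K by rewrite divr_gt0.
have [d1 d10 h1] := hf _ eK.
have eM : 0 < Num.min 1 (e / K) by rewrite lt_min ltr01.
have [d2 d20 h2] := hg _ eM.
have [d3 d30 h3] := rderiv_cts hf eK.
exists (Num.min d1 (Num.min d2 d3)); first by rewrite !lt_min d10 d20.
move=> h; rewrite !lt_min => /and3P[/h1 {}h1 /h2 {}h2 /h3 {}h3].
have -> : f (x + h) * g (x + h) - f x * g x - (d * g x + f x * d') * (h%:C)%C =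
  (f (x + h) - f x - d * (h%:C)%C) * g x
   + (f (x + h) - f x) * (g (x + h) - g x - d' * (h%:C)%C)
   + f x * (g (x + h) - g x - d' * (h%:C)%C)
   + (f (x + h) - f x) * d' * (h%:C)%C by ring.
have tri a b c (k : R[i]) : cabs (a + b + c + k) <= cabs a + cabs b + cabs c + cabs k.
  apply: (le_trans (cabsD _ _)); rewrite lerD2r.
  by apply: (le_trans (cabsD _ _)); rewrite lerD2r cabsD.
apply: (le_trans (tri _ _ _ _)).
rewrite !cabsM cabsC.
set X := cabs (f (x + h) - f x - _) in h1 *.
set Y := cabs (g (x + h) - g x - _) in h2 *.
set Z := cabs (f (x + h) - f x) in h3 *.
have n0 := normr_ge0 h.
have X0 : 0 <= X := cabs_ge0 _. have Y0 : 0 <= Y := cabs_ge0 _.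
have Z0 : 0 <= Z := cabs_ge0 _.
have Y1 : Y <= `|h| by apply: (le_trans h2); rewrite ler_piMl // ge_min lexx.
have Y2 : Y <= e / K * `|h|.
  by apply: (le_trans h2); rewrite ler_wpM2r // ge_min lexx orbT.
have -> : e * `|h| = e / K * `|h| * cabs (g x) + e / K * `|h|
   + cabs (f x) * (e / K * `|h|) + e / K * cabs d' * `|h| + e / K * `|h|.
  by rewrite /K; field; rewrite -/K gt_eqF.
have a1 : X * cabs (g x) <= e / K * `|h| * cabs (g x) by rewrite ler_wpM2r ?cabs_ge0.
have a2 : Z * Y <= e / K * `|h| by rewrite ler_pM.
have a3 : cabs (f x) * Y <= cabs (f x) * (e / K * `|h|) by rewrite ler_wpM2l ?cabs_ge0.
have a4 : Z * cabs d' * `|h| <= e / K * cabs d' * `|h|.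
  by rewrite ler_wpM2r // ler_wpM2r ?cabs_ge0.
have a5 : 0 <= e / K * `|h| by rewrite mulr_ge0 // ltW.
lra.
Qed.

Lemma rderiv_real (f : R -> R) (x d : R) :
  is_derive (x : R^o) 1 (f : R^o -> R^o) d -> rderiv (fun t => ((f t)%:C)%C) x (d%:C)%C.
Proof.
move/is_derive_eps => H e /H [dl dl0 hdl]; exists dl => // h /hdl.
by rewrite -!rmorphB -rmorphM -rmorphB cabsC.
Qed.

Lemma rderiv_scale (c : R[i]) f (x : R) d :
  rderiv f x d -> rderiv (fun t => c * f t) x (c * d).
Proof.
move=> H; have := rderivM (rderiv_cst c x) H.
by rewrite mul0r add0r.
Qed.

Lemma rderivN f (x : R) d : rderiv f x d -> rderiv (fun t => - f t) x (- d).
Proof.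
move=> /(rderiv_scale (-1)); rewrite mulN1r.
by under eq_fun do rewrite mulN1r.
Qed.

Lemma rderivB f g (x : R) d d' :
  rderiv f x d -> rderiv g x d' -> rderiv (fun t => f t - g t) x (d - d').
Proof. by move=> hf /rderivN; apply: rderivD. Qed.

Lemma rderiv_Re f (x : R) d : rderiv f x d ->
  is_derive (x : R^o) 1 ((fun t => complex.Re (f t)) : R^o -> R^o) (complex.Re d).
Proof.
move=> H; apply/is_derive_eps => e /H [dl dl0 hdl]; exists dl => // h /hdl.
apply: le_trans; apply: le_trans (Re_le_cabs _).
case: (f (x + h)) => ? ?; case: (f x) => ? ?; case: d {H hdl} => ? ? /=.
by rewrite mulr0 subr0.
Qed.

(** The real mean value theorem is applied to the real part of [w^* f], where [w = f b - f a]. Its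
    increment is [|w|^2], and one factor [|w|] is then cancelled. *)
Lemma mean_value_ineq (f f' : R -> R[i]) (a b M : R) : a <= b ->
  (forall x, a <= x <= b -> rderiv f x (f' x)) ->
  (forall x, a <= x <= b -> cabs (f' x) <= M) ->
  cabs (f b - f a) <= M * (b - a).
Proof.
move=> ab hf hM.
set w := f b - f a.
have [w0|w0] := eqVneq w 0.
  rewrite w0 cabs0 mulr_ge0 ?subr_ge0 //.
  by apply: le_trans (hM a _); rewrite ?cabs_ge0 // lexx.
have W0 : 0 < cabs w by rewrite cabs_gt0.
pose g t := complex.Re (w^* * f t).
have dg x : a <= x <= b -> is_derive (x : R^o) 1 (g : R^o -> R^o) (complex.Re (w^* * f' x)).
  by move=> /hf /(rderiv_scale (w^*)) /rderiv_Re.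
have [||c cab gE] := MVT_segment (f := g) (df := fun x => complex.Re (w^* * f' x)) ab.
- by move=> x; rewrite in_itv /= => /andP[h1 h2]; apply: dg; rewrite !ltW.
- apply: derivable_within_continuous => x; rewrite in_itv /= => /dg [] //.
have gw : g b - g a = cabs w ^+ 2.
  rewrite /g -raddfB -mulrBr -/w mulrC mulCconj //.
have : cabs w ^+ 2 <= cabs w * M * (b - a).
  rewrite -gw gE ler_wpM2r ?subr_ge0 //.
  apply: (le_trans (ler_norm _)); apply: (le_trans (Re_le_cabs _)).
  rewrite cabsM cabs_conj ler_wpM2l ?cabs_ge0 // hM //.
by rewrite expr2 -mulrA ler_pM2l.
Qed.

End Derivatives.

(** * Goursat's theorem on a parametrized square *)

Lemma geometric_small (R : realType) (q e : R) :
  0 <= q < 1 -> 0 < e -> exists n : nat, q ^+ n < e.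
Proof.
move=> /andP[q0 q1] e0.
have /cvgrPdist_lt/(_ e e0) [n _ H] : q ^+ n @[n --> \oo] --> 0.
  by apply: cvg_expr; rewrite ger0_norm.
exists n; have := H n (leqnn n).
by rewrite /= sub0r normrN ger0_norm // exprn_ge0.
Qed.

Lemma nested_intervals (R : realType) (a l : nat -> R) :
  (forall n, 0 <= l n) -> (forall n, a n <= a n.+1) ->
  (forall n, a n.+1 + l n.+1 <= a n + l n) ->
  exists x, forall n, a n <= x <= a n + l n.
Proof.
move=> l0 ha hl.
have mono n k : a n <= a (n + k)%N.
  by elim: k => [|k IH]; rewrite ?addn0 // addnS; apply: le_trans (ha _).
have anti n k : a (n + k)%N + l (n + k)%N <= a n + l n.
  by elim: k => [|k IH]; rewrite ?addn0 // addnS; apply: le_trans IH.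
have bnd n m : a n <= a m + l m.
  have [nm|/ltnW mn] := leqP n m.
    by apply: (le_trans (mono n (m - n)%N)); rewrite subnKC // lerDl.
  by have := anti m (n - m)%N; rewrite subnKC //; apply: le_trans; rewrite lerDl.
exists (sup (range a)) => n; apply/andP; split.
  apply: ub_le_sup; last by exists n.
  by exists (a 0 + l 0) => _ [k _ <-].
apply: ge_sup; first by exists (a 0), 0.
by move=> _ [k _ <-].
Qed.

Section Goursat.
Context {R : realType}.

(* If TB and SA are primitives, in the second and in the first variable, of the
   components of a form g dP, then box (TB - SA) is its integral round the square. *)
Definition box (W : R -> R -> R[i]) (a b l : R) : R[i] :=
  W (a + l) (b + l) - W (a + l) b - W a (b + l) + W a b.

Section Bisection.
Variables (W : R -> R -> R[i]) (c : R).

Let heavy l (p : R * R) := c * l ^+ 2 <= cabs (box W p.1 p.2 l).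

(** The last quarter is the default: if the other three are not heavy, additivity of [box] makes it
    heavy. *)
Let quarter l (p : R * R) :=
  if heavy l p then p
  else if heavy l (p.1 + l, p.2) then (p.1 + l, p.2)
  else if heavy l (p.1, p.2 + l) then (p.1, p.2 + l)
  else (p.1 + l, p.2 + l).

Let corner := fix corner n :=
  if n is n'.+1 then quarter (2^-1 ^+ n) (corner n') else (0, 0).

(** [box] is additive over the four quarters of a square, while the area is divided by 4; a lower
    bound proportional to the area therefore passes to at least one quarter. The nested squares so
    chosen shrink to the point [(x, y)]. *)
Lemma heavy_squares : c <= cabs (box W 0 0 1) ->
  exists x y, [/\ 0 <= x <= 1, 0 <= y <= 1 & forall n, exists a b,
    [/\ 0 <= a & a + 2^-1 ^+ n <= 1] /\ [/\ 0 <= b & b + 2^-1 ^+ n <= 1] /\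
    [/\ a <= x <= a + 2^-1 ^+ n, b <= y <= b + 2^-1 ^+ n &
        c * (2^-1 ^+ n) ^+ 2 <= cabs (box W a b (2^-1 ^+ n))]].
Proof.
move=> hc.
have half n : 2^-1 ^+ n.+1 + 2^-1 ^+ n.+1 = 2^-1 ^+ n :> R by rewrite !exprS; field.
have pos n : 0 < 2^-1 ^+ n :> R by rewrite exprn_gt0 // invr_gt0.
have hvy n : heavy (2^-1 ^+ n) (corner n).
  elim: n => [|n IH]; first by rewrite /heavy /= expr0 expr1n mulr1.
  rewrite [corner _]/= /quarter; set l := 2^-1 ^+ n.+1; set p := corner n in IH *.
  have hl : 2^-1 ^+ n = l + l by rewrite half.
  case: ifPn => // n1; case: ifPn => // n2; case: ifPn => // n3.
  rewrite /heavy /= in IH n1 n2 n3 *; rewrite hl in IH.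
  move: n1 n2 n3; rewrite -!ltNge => n1 n2 n3; rewrite leNgt; apply/negP => n4.
  have E : box W p.1 p.2 (l + l) = box W p.1 p.2 l + box W (p.1 + l) p.2 l +
     box W p.1 (p.2 + l) l + box W (p.1 + l) (p.2 + l) l.
    by rewrite /box !addrA; ring.
  move: IH; rewrite E leNgt => /negP; apply.
  apply: (le_lt_trans (cabsD _ _)).
  have := cabsD (box W p.1 p.2 l + box W (p.1 + l) p.2 l) (box W p.1 (p.2 + l) l).
  have := cabsD (box W p.1 p.2 l) (box W (p.1 + l) p.2 l).
  have -> : c * (l + l) ^+ 2 = 4 * (c * l ^+ 2) by ring.
  lra.
have st n : [/\ (corner n).1 <= (corner n.+1).1, (corner n).2 <= (corner n.+1).2,
    (corner n.+1).1 + 2^-1 ^+ n.+1 <= (corner n).1 + 2^-1 ^+ n &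
    (corner n.+1).2 + 2^-1 ^+ n.+1 <= (corner n).2 + 2^-1 ^+ n].
  rewrite -(half n) [corner n.+1]/= /quarter.
  have := pos n.+1; set l := 2^-1 ^+ n.+1 => l0.
  by case: ifP => _; [|case: ifP => _; [|case: ifP => _]] => /=; split; lra.
have inv n : 0 <= (corner n).1 /\ (corner n).1 + 2^-1 ^+ n <= 1 /\
   0 <= (corner n).2 /\ (corner n).2 + 2^-1 ^+ n <= 1.
  elim: n => [|n [i1 [i2 [i3 i4]]]]; first by rewrite /= expr0 !add0r !lexx.
  have [s1 s2 s3 s4] := st n; lra.
have [x hx] : exists x, forall n, (corner n).1 <= x <= (corner n).1 + 2^-1 ^+ n.
  by apply: nested_intervals => n; [exact: ltW|case: (st n)..].
have [y hy] : exists y, forall n, (corner n).2 <= y <= (corner n).2 + 2^-1 ^+ n.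
  by apply: nested_intervals => n; [exact: ltW|case: (st n)..].
exists x, y; split.
- by have := hx 0; rewrite /= expr0 add0r.
- by have := hy 0; rewrite /= expr0 add0r.
move=> n; exists (corner n).1, (corner n).2; have [i1 [i2 [i3 i4]]] := inv n.
by split=> //; split=> //; split=> //; apply: hvy.
Qed.

End Bisection.

(** At the limit point of the heavy squares, the local bound with [e] equal to half of
    [|box W 0 0 1|] contradicts heaviness. *)
Lemma box_eq0 (W : R -> R -> R[i]) :
  (forall x y, 0 <= x <= 1 -> 0 <= y <= 1 -> forall e, 0 < e ->
   exists2 dl, 0 < dl & forall a b l, 0 < l -> l < dl ->
     0 <= a -> a + l <= 1 -> 0 <= b -> b + l <= 1 ->
     a <= x <= a + l -> b <= y <= b + l -> cabs (box W a b l) <= e * l ^+ 2) ->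
  box W 0 0 1 = 0.
Proof.
move=> H; apply/eqP; rewrite -cabs_eq0; apply/negPn/negP => c0.
have {}c0 : 0 < cabs (box W 0 0 1) by rewrite lt_neqAle eq_sym c0 cabs_ge0.
have [x [y [hx hy Hn]]] := heavy_squares (lexx (cabs (box W 0 0 1))).
have c2 : 0 < cabs (box W 0 0 1) / 2 by rewrite divr_gt0.
have [dl dl0 hdl] := H x y hx hy _ c2.
have [n nl] : exists n, 2^-1 ^+ n < dl by apply: geometric_small => //; lra.
have [a [b [[a0 a1] [[b0 b1] [xa yb hv]]]]] := Hn n.
have l0 : 0 < 2^-1 ^+ n :> R by rewrite exprn_gt0 // invr_gt0.
have := le_trans hv (hdl _ _ _ l0 nl a0 a1 b0 b1 xa yb).
by rewrite ler_pM2r ?exprn_gt0 //; lra.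
Qed.

(** Goursat for the form [g dP] on the unit square, with the integrals along the sides expressed
    through partial primitives. Close to a point, [g] is affine up to a small error. The affine part
    has the primitive [Q] and contributes nothing; the error along the sides of a square of side [l]
    is small compared with [l^2]. *)
Lemma goursat_param (g : R[i] -> R[i]) (P Px Py SA TB : R -> R -> R[i]) (M : R) :
  (forall x y, 0 <= x <= 1 -> 0 <= y <= 1 ->
    [/\ exists d, cderiv g (P x y) d,
        rderiv (P^~ y) x (Px x y), rderiv (P x) y (Py x y),
        cabs (Px x y) <= M & cabs (Py x y) <= M]) ->
  (forall x y, 0 <= x <= 1 -> 0 <= y <= 1 ->
    rderiv (SA^~ y) x (g (P x y) * Px x y) /\
    rderiv (TB x) y (g (P x y) * Py x y)) ->
  TB 1 1 - TB 1 0 - (TB 0 1 - TB 0 0) = SA 1 1 - SA 0 1 - (SA 1 0 - SA 0 0).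
Proof.
move=> HP HS.
suff : box (fun x y => TB x y - SA x y) 0 0 1 = 0.
  rewrite /box !add0r => E; apply/eqP; rewrite -subr_eq0 -E; apply/eqP; ring.
apply: box_eq0 => x y hx hy e e0.
have [[d gd] _ _ hM _] := HP x y hx hy.
have M0 : 0 <= M := le_trans (cabs_ge0 _) hM.
(* On a square of side [l] the points [P s t] stay within [2 M l] of [z], so each side contributes
   at most [2 e' M^2 l^2], which has to be at most a quarter of [e l^2]; [M + 1] keeps the
   denominator positive. *)
set e' := e / (8 * (M + 1) ^+ 2).
have K0 : 0 < 8 * (M + 1) ^+ 2 by rewrite mulr_gt0 // exprn_gt0 //; lra.
have e'0 : 0 < e' by rewrite divr_gt0.
have [dl dl0 hdl] := gd _ e'0.
set z := P x y in gd hdl.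
exists (dl / (2 * (M + 1))); first by rewrite divr_gt0 //; lra.
move=> a b l l0 lt a0 a1 b0 b1 xa yb.
have inS s t : a <= s <= a + l -> b <= t <= b + l -> 0 <= s <= 1 /\ 0 <= t <= 1.
  by move=> *; lra.
have mvx s s' t : a <= s -> s <= s' -> s' <= a + l -> b <= t <= b + l ->
    cabs (P s' t - P s t) <= M * (s' - s).
  move=> h1 h2 h3 h4; apply: (@mean_value_ineq _ (P^~ t) (Px^~ t)) => // v hv.
    have hv' : a <= v <= a + l by lra.
    by have [? ?] := inS v t hv' h4; case: (HP v t).
  have hv' : a <= v <= a + l by lra.
  by have [? ?] := inS v t hv' h4; case: (HP v t).
have mvy s t t' : b <= t -> t <= t' -> t' <= b + l -> a <= s <= a + l ->
    cabs (P s t' - P s t) <= M * (t' - t).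
  move=> h1 h2 h3 h4; apply: (@mean_value_ineq _ (P s) (Py s)) => // v hv.
    have hv' : b <= v <= b + l by lra.
    by have [? ?] := inS s v h4 hv'; case: (HP s v).
  have hv' : b <= v <= b + l by lra.
  by have [? ?] := inS s v h4 hv'; case: (HP s v).
have near s t : a <= s <= a + l -> b <= t <= b + l -> cabs (P s t - z) <= 2 * (M * l).
  move=> hs ht.
  have h1 : cabs (P s t - P x t) <= M * l.
    have [sx|sx] := leP s x.
      rewrite cabs_distC; apply: le_trans (mvx s x t _ sx _ ht) _; [lra|lra|].
      by rewrite ler_wpM2l //; lra.
    apply: le_trans (mvx x s t _ (ltW sx) _ ht) _; [lra|lra|].
    by rewrite ler_wpM2l //; lra.
  have h2 : cabs (P x t - z) <= M * l.
    have [sx|sx] := leP t y.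
      rewrite cabs_distC; apply: le_trans (mvy x t y _ sx _ xa) _; [lra|lra|].
      by rewrite ler_wpM2l //; lra.
    apply: le_trans (mvy x y t _ (ltW sx) _ xa) _; [lra|lra|].
    by rewrite ler_wpM2l //; lra.
  have -> : P s t - z = (P s t - P x t) + (P x t - z) by ring.
  by apply: (le_trans (cabsD _ _)); lra.
pose Q w := g z * w + d * ((w - z) * (w - z)) / 2.
have err s t : a <= s <= a + l -> b <= t <= b + l ->
    cabs (g (P s t) - (g z + d * (P s t - z))) <= e' * (2 * (M * l)).
  move=> hs ht; have hn := near s t hs ht.
  have hd : cabs (P s t - z) < dl.
    apply: (le_lt_trans hn); move: lt; rewrite ltr_pdivlMr; last lra.
    by apply: le_lt_trans; lra.
  have := hdl _ hd; rewrite subrKC -addrA -opprD => /le_trans; apply.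
  by rewrite ler_wpM2l // ltW.
have dQ (p : R -> R[i]) v p' : rderiv p v p' ->
   rderiv (fun v => Q (p v)) v ((g z + d * (p v - z)) * p').
  move=> hp.
  have hpz : rderiv (fun v => p v - z) v p'.
    by have := rderivB hp (rderiv_cst z v); rewrite subr0.
  have := rderivD (rderiv_scale (g z) hp) (rderiv_scale (d / 2) (rderivM hpz hpz)).
  rewrite /Q; set r1 := (X in rderiv _ _ X) => h1.
  have -> : (g z + d * (p v - z)) * p' = r1 by rewrite /r1; field.
  by move: h1; congr (rderiv _ _ _); apply/funext => w; ring.
set D := e' * (2 * (M * l)) * M.
have D0 : D * l <= e * l ^+ 2 / 4.
  rewrite /D; have -> : e = e' * (8 * (M + 1) ^+ 2) by rewrite /e' divfK // gt_eqF.
  rewrite -subr_ge0.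
  have -> : e' * (8 * (M + 1) ^+ 2) * l ^+ 2 / 4 - e' * (2 * (M * l)) * M * l
    = e' * l ^+ 2 * (4 * M + 2) by field.
  by apply: mulr_ge0; [apply: mulr_ge0; [exact: ltW|exact: exprn_ge0 (ltW l0)]|lra].
have incT s : a <= s <= a + l ->
   cabs ((TB s (b + l) - Q (P s (b + l))) - (TB s b - Q (P s b))) <= e * l ^+ 2 / 4.
  move=> hs; apply: le_trans D0; have -> : D * l = D * (b + l - b) by ring.
  apply: (@mean_value_ineq _ (fun t => TB s t - Q (P s t))
    (fun t => (g (P s t) - (g z + d * (P s t - z))) * Py s t)); first lra.
    move=> t ht; have [i1 i2] := inS _ _ hs ht.
    rewrite mulrBl; apply: rderivB; first by case: (HS s t).
    by apply: dQ; case: (HP s t).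
  move=> t ht; have [i1 i2] := inS _ _ hs ht.
  by rewrite cabsM ler_pM ?cabs_ge0 ?err //; case: (HP s t).
have incS t : b <= t <= b + l ->
   cabs ((SA (a + l) t - Q (P (a + l) t)) - (SA a t - Q (P a t))) <= e * l ^+ 2 / 4.
  move=> ht; apply: le_trans D0; have -> : D * l = D * (a + l - a) by ring.
  apply: (@mean_value_ineq _ (fun s => SA s t - Q (P s t))
    (fun s => (g (P s t) - (g z + d * (P s t - z))) * Px s t)); first lra.
    move=> s hs; have [i1 i2] := inS _ _ hs ht.
    rewrite mulrBl; apply: rderivB; first by case: (HS s t).
    by apply: (dQ (P^~ t)); case: (HP s t).
  move=> s hs; have [i1 i2] := inS _ _ hs ht.
  by rewrite cabsM ler_pM ?cabs_ge0 ?err //; case: (HP s t).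
(* The values of [Q] at the four corners cancel. *)
have -> : box (fun x y => TB x y - SA x y) a b l =
  ((TB (a + l) (b + l) - Q (P (a + l) (b + l))) - (TB (a + l) b - Q (P (a + l) b)))
  + - ((TB a (b + l) - Q (P a (b + l))) - (TB a b - Q (P a b)))
  + - ((SA (a + l) (b + l) - Q (P (a + l) (b + l))) - (SA a (b + l) - Q (P a (b + l))))
  + ((SA (a + l) b - Q (P (a + l) b)) - (SA a b - Q (P a b))).
  by rewrite /box; ring.
have tri p q r (k : R[i]) : cabs (p + - q + - r + k) <= cabs p + cabs q + cabs r + cabs k.
  apply: (le_trans (cabsD _ _)); rewrite lerD2r.
  apply: (le_trans (cabsD _ _)); rewrite cabsN lerD2r.
  by apply: (le_trans (cabsD _ _)); rewrite cabsN.
apply: (le_trans (tri _ _ _ _)).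
have ha : a <= a <= a + l by lra. have ha' : a <= a + l <= a + l by lra.
have hb : b <= b <= b + l by lra. have hb' : b <= b + l <= b + l by lra.
have := incT _ ha; have := incT _ ha'; have := incS _ hb; have := incS _ hb'.
lra.
Qed.

End Goursat.

(** * Mean values of complex functions of a real variable *)

Section Primitives.
Context {R : realType}.

Definition rcts (phi : R -> R[i]) (x : R) : Prop :=
  forall e, 0 < e -> exists2 dl, 0 < dl &
  forall h, `|h| < dl -> cabs (phi (x + h) - phi x) <= e.

Lemma rderiv_rcts f (x : R) d : rderiv f x d -> rcts f x.
Proof. by move=> h; exact: rderiv_cts h. Qed.

Lemma real_primitive (f : R -> R) : continuous f ->
  exists F : R -> R, forall x, 0 <= x <= 1 -> is_derive (x : R^o) 1 (F : R^o -> R^o) (f x).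
Proof.
move=> fc.
(* Integrating from -1, with integrability up to 3, makes every point of [[0, 1]] interior, so the
   derivative is two-sided at 0 and 1 as well. *)
exists (fun x => \int[lebesgue_measure]_(t in [set` Interval (BLeft (-1 : R)) (BRight x)]) f t)%R.
move=> x /andP[x0 x1].
have x3 : x < 3 by apply: (le_lt_trans x1); lra.
have int : lebesgue_measure.-integrable [set` Interval (BLeft (-1 : R)) (BRight 3)] (EFin \o f).
  apply: continuous_compact_integrable; first exact: segment_compact.
  exact: continuous_subspaceT.
have m1x : -1 < x by apply: lt_le_trans x0; lra.
have := continuous_FTC1 x3 int; rewrite lte_fin => H.
have [d1 d2] := H m1x (fc x).
by split=> //; rewrite -derive1E.
Qed.

(** Composition with this retraction turns a function continuous at the points of [[0, 1]] into one
    continuous on the whole line. *)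
Definition clamp (x : R) : R := Num.max 0 (Num.min x 1).

Lemma clamp01 x : 0 <= clamp x <= 1.
Proof. by rewrite /clamp le_max lexx /= ge_max ge_min lexx ler01 orbT. Qed.

Lemma clamp_id x : 0 <= x <= 1 -> clamp x = x.
Proof. by case/andP=> x0 x1; rewrite /clamp min_l // max_r. Qed.

Lemma clamp_lip x h : `|clamp (x + h) - clamp x| <= `|h|.
Proof.
have h1 := ler_norm h; have h2 := ler_norm (- h); rewrite normrN in h2.
rewrite /clamp ler_norml.
case: (leP (x + h) 1) => ?; case: (leP x 1) => ?;
  rewrite ?(max_r ler01); case: (leP 0 (x + h)) => ?; case: (leP 0 x) => ?; lra.
Qed.

(** The continuity hypothesis sits under the existential, so that a candidate exists for every [phi]
    and can be selected as a total function. *)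
Lemma primitive_ex (phi : R -> R[i]) :
  exists Phi, (forall x, 0 <= x <= 1 -> rcts phi x) ->
    forall x, 0 <= x <= 1 -> rderiv Phi x (phi x).
Proof.
have [pc|] := pselect (forall x, 0 <= x <= 1 -> rcts phi x); last first.
  by exists phi.
have cc (p : R[i] -> R) : (forall z w, `|p z - p w| <= cabs (z - w)) ->
    continuous (fun x => p (phi (clamp x))).
  move=> hp x; apply/cvgrPdist_le => /= e e0.
  have [dl dl0 hdl] := pc _ (clamp01 x) _ e0.
  exists dl => // y; rewrite /ball_ /= => xy.
  apply: (le_trans (hp _ _)); rewrite cabs_distC.
  rewrite -[clamp y](subrKC (clamp x)); apply: hdl.
  apply: le_lt_trans xy; rewrite distrC.
  by have := clamp_lip x (y - x); rewrite subrKC distrC [`|y - x|]distrC.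
have lipRe (z w : R[i]) : `|complex.Re z - complex.Re w| <= cabs (z - w).
  by rewrite -raddfB Re_le_cabs.
have lipIm (z w : R[i]) : `|complex.Im z - complex.Im w| <= cabs (z - w).
  by rewrite -raddfB Im_le_cabs.
have [F1 h1] := real_primitive (cc _ lipRe).
have [F2 h2] := real_primitive (cc _ lipIm).
exists (fun x => ((F1 x)%:C)%C + ('i)%C * ((F2 x)%:C)%C) => _ x hx.
have -> : phi x =
    (complex.Re (phi (clamp x)))%:K + ('i)%C * (complex.Im (phi (clamp x)))%:K.
  by rewrite clamp_id // {1}[phi x]complexE.
by apply: rderivD; [|apply: rderiv_scale]; apply: rderiv_real; auto.
Qed.

(* A junk function unless phi is continuous at every point of [0, 1]. *)
Definition prim (phi : R -> R[i]) : R -> R[i] := projT1 (cid (primitive_ex phi)).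

Lemma primP phi x : (forall x, 0 <= x <= 1 -> rcts phi x) -> 0 <= x <= 1 ->
  rderiv (prim phi) x (phi x).
Proof. by rewrite /prim; case: cid => Phi /= h hp; apply: h. Qed.

(** The integral over [[0, 1]]; for a function of [cis y] it is the mean over the unit circle. *)
Definition avg (phi : R -> R[i]) : R[i] := prim phi 1 - prim phi 0.

(** Two primitives of [phi] differ by a function with derivative 0, to which [mean_value_ineq]
    applies with bound 0. *)
Lemma avg_unique phi Phi :
  (forall x, 0 <= x <= 1 -> rderiv Phi x (phi x)) ->
  (forall x, 0 <= x <= 1 -> rcts phi x) -> avg phi = Phi 1 - Phi 0.
Proof.
move=> hP hc; apply/eqP; rewrite -subr_eq0 -cabs_eq0 eq_le cabs_ge0 andbT.
have := @mean_value_ineq _ (fun x => prim phi x - Phi x) (fun=> 0) 0 1 0 ler01.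
rewrite mul0r => h; have := h _ _; rewrite /avg.
have -> : prim phi 1 - prim phi 0 - (Phi 1 - Phi 0) = prim phi 1 - Phi 1 - (prim phi 0 - Phi 0).
  by ring.
apply => x hx; last by rewrite cabs0.
by rewrite -(subrr (phi x)); apply: rderivB; [exact: primP|exact: hP].
Qed.

Lemma avg_bound phi M :
  (forall x, 0 <= x <= 1 -> rcts phi x) ->
  (forall x, 0 <= x <= 1 -> cabs (phi x) <= M) -> cabs (avg phi) <= M.
Proof.
move=> hc hM; rewrite -[M]mulr1 -[X in M * X](subr0 1).
by apply: (@mean_value_ineq _ (prim phi) phi) => // x hx; exact: primP.
Qed.

Lemma rctsD f g (x : R) : rcts f x -> rcts g x -> rcts (fun t => f t + g t) x.
Proof.
move=> hf hg e e0; have e2 : 0 < e / 2 by rewrite divr_gt0.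
have [d1 d10 h1] := hf _ e2; have [d2 d20 h2] := hg _ e2.
exists (Num.min d1 d2); first by rewrite lt_min d10.
move=> h; rewrite lt_min => /andP[/h1 {}h1 /h2 {}h2].
have -> : f (x + h) + g (x + h) - (f x + g x) = (f (x + h) - f x) + (g (x + h) - g x) by ring.
by apply: (le_trans (cabsD _ _)); lra.
Qed.

Lemma rctsM f g (x : R) : rcts f x -> rcts g x -> rcts (fun t => f t * g t) x.
Proof.
move=> hf hg e e0.
set K := 1 + cabs (g x) + cabs (f x).
have K0 : 0 < K by rewrite /K; move: (cabs_ge0 (g x)) (cabs_ge0 (f x)); lra.
have eK : 0 < e / K by rewrite divr_gt0.
have eM : 0 < Num.min 1 (e / K) by rewrite lt_min ltr01.
have [d1 d10 h1] := hf _ eK; have [d2 d20 h2] := hg _ eM.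
exists (Num.min d1 d2); first by rewrite !lt_min d10.
move=> h; rewrite !lt_min => /andP[/h1 {}h1 /h2 {}h2].
move: h2; rewrite le_min => /andP[h2 h3].
have -> : f (x + h) * g (x + h) - f x * g x =
  (f (x + h) - f x) * g x + (f (x + h) - f x) * (g (x + h) - g x)
   + f x * (g (x + h) - g x) by ring.
apply: (le_trans (cabsD _ _)); apply: (le_trans (lerD (cabsD _ _) (lexx _))).
rewrite !cabsM.
have -> : e = e / K * cabs (g x) + e / K * 1 + cabs (f x) * (e / K).
  by rewrite /K; field; rewrite -/K gt_eqF.
by rewrite !lerD // ?ler_wpM2r ?ler_wpM2l ?ler_pM ?cabs_ge0.
Qed.

Lemma rcts_cst c (x : R) : rcts (fun=> c) x.
Proof. exact: rderiv_rcts (rderiv_cst c x). Qed.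

Lemma rctsV f (x : R) : f x != 0 -> rcts f x -> rcts (fun t => (f t)^-1) x.
Proof.
move=> f0 hf e e0; have F0 : 0 < cabs (f x) by rewrite cabs_gt0.
have F2 : 0 < cabs (f x) / 2 by rewrite divr_gt0.
have eK : 0 < e * cabs (f x) ^+ 2 / 2 by rewrite divr_gt0 // mulr_gt0 // exprn_gt0.
have [d1 d10 h1] := hf _ F2; have [d2 d20 h2] := hf _ eK.
exists (Num.min d1 d2); first by rewrite !lt_min d10.
move=> h; rewrite lt_min => /andP[/h1 {}h1 /h2 {}h2].
have fh : cabs (f x) / 2 <= cabs (f (x + h)).
  by have := cabs_subl (f x) (f (x + h)); rewrite cabs_distC; lra.
have fh0 : 0 < cabs (f (x + h)) by lra.
have -> : (f (x + h))^-1 - (f x)^-1 = - (f (x + h) - f x) / (f (x + h) * f x).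
  by field; rewrite f0 -cabs_gt0.
rewrite cabsM cabsN cabsV cabsM ler_pdivrMr ?mulr_gt0 //.
apply: (le_trans h2); rewrite -mulrA; apply: ler_wpM2l; first exact: ltW.
by rewrite expr2 mulrAC; apply: ler_wpM2r => //; exact: ltW.
Qed.

Lemma rcts_comp (f : R[i] -> R[i]) p (x : R) d :
  cderiv f (p x) d -> rcts p x -> rcts (fun t => f (p t)) x.
Proof.
move=> /cderiv_cts hf hp e /hf [d1 d10 h1].
have d2 : 0 < d1 / 2 by rewrite divr_gt0.
have [d3 d30 h3] := hp _ d2; exists d3 => // h /h3 hh.
by have := h1 (p (x + h) - p x); rewrite subrKC; apply; lra.
Qed.

Lemma avg_lin a b phi psi :
  (forall x, 0 <= x <= 1 -> rcts phi x) -> (forall x, 0 <= x <= 1 -> rcts psi x) ->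
  avg (fun x => a * phi x + b * psi x) = a * avg phi + b * avg psi.
Proof.
move=> h1 h2; rewrite (@avg_unique _ (fun x => a * prim phi x + b * prim psi x)).
- by rewrite /avg; ring.
- by move=> x hx; apply: rderivD; apply: rderiv_scale; apply: primP.
- by move=> x hx; apply: rctsD; apply: rctsM; [exact: rcts_cst|exact: h1|exact: rcts_cst|exact: h2].
Qed.

End Primitives.

(** * Complex differentiability and the unit circle *)

Section Cauchy.
Context {R : realType}.

Definition cdiff (f : R[i] -> R[i]) (z : R[i]) : Prop := exists d, cderiv f z d.

Lemma cdiffP f (z : R[i]) : cdiff f z <-> derivable (f : R[i]^o -> R[i]^o) z 1.
Proof. by rewrite derivable_cderiv. Qed.

Lemma cdiff_cst c (z : R[i]) : cdiff (fun=> c) z.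
Proof. by apply/cdiffP; exact: derivable_cst. Qed.

Lemma cdiff_id (z : R[i]) : cdiff id z.
Proof. by apply/cdiffP; exact: derivable_id. Qed.

Lemma cdiffD f g (z : R[i]) : cdiff f z -> cdiff g z -> cdiff (fun w => f w + g w) z.
Proof. by move=> /cdiffP hf /cdiffP hg; apply/cdiffP; apply: derivableD hf hg. Qed.

Lemma cdiffM f g (z : R[i]) : cdiff f z -> cdiff g z -> cdiff (fun w => f w * g w) z.
Proof. by move=> /cdiffP hf /cdiffP hg; apply/cdiffP; apply: derivableM hf hg. Qed.

Lemma cdiffN f (z : R[i]) : cdiff f z -> cdiff (fun w => - f w) z.
Proof. by move=> /cdiffP hf; apply/cdiffP; apply: derivableN hf. Qed.

Lemma cdiffB f g (z : R[i]) : cdiff f z -> cdiff g z -> cdiff (fun w => f w - g w) z.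
Proof. by move=> hf hg; apply: cdiffD => //; apply: cdiffN. Qed.

Lemma cdiffV f (z : R[i]) : f z != 0 -> cdiff f z -> cdiff (fun w => (f w)^-1) z.
Proof. by move=> f0 /cdiffP hf; apply/cdiffP; apply: (derivableV (V := R[i]^o)) f0 hf. Qed.

Lemma cdiffX f n (z : R[i]) : cdiff f z -> cdiff (fun w => f w ^+ n) z.
Proof.
move=> hf; elim: n => [|n IH].
  by under eq_fun do rewrite expr0; exact: cdiff_cst.
by under eq_fun do rewrite exprS; exact: cdiffM.
Qed.

Lemma cdiff_affine f a c (z : R[i]) : cdiff f (a + c * z) -> cdiff (fun w => f (a + c * w)) z.
Proof.
move=> [d hd]; exists (c * d) => e e0.
have [c0|c0] := eqVneq c 0.
  exists 1 => // h _; rewrite c0 !mul0r subrr subr0 cabs0.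
  by rewrite mulr_ge0 ?cabs_ge0 // ltW.
have C0 : 0 < cabs c by rewrite cabs_gt0.
have [|dl dl0 hdl] := hd (e / cabs c); first exact: divr_gt0.
exists (dl / cabs c); first exact: divr_gt0.
move=> h; rewrite ltr_pdivlMr // => hh.
have := hdl (c * h); rewrite cabsM mulrC hh => /(_ isT).
rewrite mulrDr addrA (mulrC c d) mulrA; move/le_trans; apply.
by rewrite [cabs h * _]mulrC mulrA divfK // gt_eqF.
Qed.

Lemma cdiff_near f g (z : R[i]) (dl : R) : 0 < dl ->
  (forall w, cabs (w - z) < dl -> f w = g w) -> cdiff f z -> cdiff g z.
Proof.
move=> dl0 E [d hd]; exists d => e e0; have [d1 d10 h1] := hd _ e0.
exists (Num.min dl d1); first by rewrite lt_min dl0.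
move=> h; rewrite lt_min => /andP[h2 /h1].
by rewrite !E // ?subrr ?cabs0 // addrAC subrr add0r.
Qed.

(** The exponential [e^{2 pi i y}], of period 1, so that [[0, 1]] runs once round the circle. *)
Definition cis (y : R) : R[i] := ((cos (2 * pi * y))%:C + 'i * (sin (2 * pi * y))%:C)%C.

Lemma cisE y : cis y = (cos (2 * pi * y) +i* sin (2 * pi * y))%C.
Proof. by rewrite /cis; simpc. Qed.

Lemma cabs_cis y : cabs (cis y) = 1.
Proof. by rewrite cisE /cabs /= cos2Dsin2 sqrtr1. Qed.

Lemma cis_conj y : cis y * (cis y)^* = 1.
Proof. by rewrite mulCconj cabs_cis expr1n. Qed.

Lemma cis_neq0 y : cis y != 0.
Proof. by rewrite -cabs_gt0 cabs_cis. Qed.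

Lemma cisV y : (cis y)^* = (cis y)^-1.
Proof. by apply: (mulfI (cis_neq0 y)); rewrite cis_conj divff // cis_neq0. Qed.

Lemma cis0 : cis 0 = 1.
Proof. by rewrite cisE mulr0 cos0 sin0. Qed.

Lemma cis1 : cis 1 = 1.
Proof. by rewrite cisE mulr1 [2 * pi]mulrC mulr_natr cos2pi sin2pi. Qed.

Lemma cis_polar (z : R[i]) : exists2 y, 0 <= y <= 1 & z = (cabs z)%:K * cis y.
Proof.
have pi0 : 0 < 2 * pi :> R by rewrite mulr_gt0 // pi_gt0.
have [->|z0] := eqVneq z 0; first by exists 0; rewrite ?lexx ?ler01 // cabs0 mul0r.
have C0 : 0 < cabs z by rewrite cabs_gt0.
set a := complex.Re z / cabs z; set b := complex.Im z / cabs z.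
have ab : a ^+ 2 + b ^+ 2 = 1.
  by rewrite /a /b !expr_div_n -mulrDl -cabs_sqr divff // expf_neq0 // gt_eqF.
have a1 : -1 <= a <= 1.
  rewrite -ler_norml -(@ler_pXn2r _ 2) ?nnegrE // expr1n real_normK ?num_real //.
  by rewrite -ab lerDl sqr_ge0.
have zE : z = ((cabs z)%:C)%C * (a +i* b)%C.
  rewrite /a /b; case: z z0 C0 {a b ab a1} => x y /= _ C0; simpc.
  by congr (_ +i* _)%C; rewrite mulrC divfK // gt_eqF.
have sE : sin (acos a) = `|b|.
  by rewrite sin_acos // -ab addrC addKr sqrtr_sqr.
have t0 := acos_ge0 a1; have t1 := acos_lepi a1; have p0 := pi_gt0 R.
have [b0|b0] := leP 0 b.
  exists (acos a / (2 * pi)).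
    by apply/andP; split; [apply: divr_ge0; lra|rewrite ler_pdivrMr //; lra].
  rewrite cisE [2 * pi * _]mulrC divfK ?gt_eqF // sE ger0_norm //.
  by rewrite acosK ?in_itv.
exists ((2 * pi - acos a) / (2 * pi)).
  by apply/andP; split; [apply: divr_ge0; lra|rewrite ler_pdivrMr //; lra].
rewrite cisE [2 * pi * _]mulrC divfK ?gt_eqF //.
rewrite [2 * pi]mulrC mulr_natr [_ - acos a]addrC cosD2pi sinD2pi cosN sinN.
by rewrite acosK ?in_itv // sE ltr0_norm // opprK.
Qed.

Lemma rderiv_cis y : rderiv cis y (((2 * pi)%:C * 'i)%C * cis y).
Proof.
have dl : is_derive (y : R^o) 1 ((fun y => 2 * pi * y) : R^o -> R^o) (2 * pi).
  by apply/is_derive_eps => e e0; exists 1 => // h _;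
    rewrite mulrDr [_ + _ * h]addrC addrK subrr normr0 mulr_ge0 // ltW.
have d1 := rderiv_real (is_derive1_comp (is_derive_cos (2 * pi * y)) dl).
have d2 := rderiv_real (is_derive1_comp (is_derive_sin (2 * pi * y)) dl).
have := rderivD d1 (rderiv_scale ('i)%C d2); rewrite /cis.
by congr (rderiv _ _ _); simpc; congr (_ +i* _)%C; ring.
Qed.

End Cauchy.

(** * Cauchy's formula and Taylor expansions *)

Section CauchyFormula.
Context {R : realType}.
Implicit Types (f : R[i] -> R[i]) (rho : R).

Lemma rcts_cis y : rcts (@cis R) y.
Proof. exact: rderiv_rcts (rderiv_cis y). Qed.

Lemma rderiv_affine (a b : R[i]) (x : R) : rderiv (fun x => a + b * (x%:C)%C) x b.
Proof.
move=> e e0; exists 1 => // h _.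
by rewrite rmorphD mulrDr addrA [_ + b * _]addrC addrK subrr cabs0 mulr_ge0 // ltW.
Qed.

Lemma cabs_2pi_i : cabs ((2 * pi : R)%:C * 'i)%C = 2 * pi.
Proof.
rewrite cabsM cabsC ger0_norm ?mulr_ge0 ?pi_ge0 //.
by rewrite /cabs /= expr0n expr1n add0r sqrtr1 mulr1.
Qed.

(** Goursat for [f z / (z - a)] along [P x y = a + sg x (rho cis y - a)], with [sg] running linearly
    from [dl] to 1. Since [dl > 0], the path avoids [a]; it stays in the disc by convexity. On the
    side [x = 0] the factor [dl] cancels between [Py] and [P - a], so both means carry the same
    kernel. *)
Lemma mean_homotopy f (a : R[i]) rho dl : 0 < rho -> cabs a < rho -> 0 < dl < 1 ->
  (forall z, cabs z <= rho -> cdiff f z) ->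
  avg (fun y => f (rho%:K * cis y) /
    (rho%:K * cis y - a) * (rho%:K * (((2 * pi)%:C * 'i)%C * cis y))) =
  avg (fun y => f (a + dl%:K * (rho%:K * cis y - a)) /
    (rho%:K * cis y - a) * (rho%:K * (((2 * pi)%:C * 'i)%C * cis y))).
Proof.
move=> rho0 ar dl01 hf.
pose sg x : R[i] := dl%:K + (1 - dl)%:K * x%:K.
pose q y : R[i] := rho%:K * cis y - a.
pose q' y : R[i] := rho%:K * (((2 * pi)%:C * 'i)%C * cis y).
pose P x y := a + sg x * q y.
pose Px (x : R) y := (1 - dl)%:K * q y.
pose Py x y := sg x * q' y.
pose g z := f z / (z - a).
have sgE x : sg x = (dl + (1 - dl) * x)%:K by rewrite /sg -rmorphM -rmorphD.
have sg_bd x : 0 <= x <= 1 -> dl <= dl + (1 - dl) * x <= 1.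
  move=> hx; have h1 : 0 <= (1 - dl) * x by rewrite mulr_ge0; lra.
  have h2 : 0 <= (1 - dl) * (1 - x) by rewrite mulr_ge0; lra.
  by lra.
have sg0 x : 0 <= x <= 1 -> sg x != 0.
  by move=> /sg_bd hx; rewrite -cabs_gt0 sgE cabsC normr_gt0 gt_eqF //; lra.
have q0 y : q y != 0.
  rewrite -cabs_gt0; have := cabs_subl (rho%:K * cis y) a.
  by rewrite cabsM cabsC cabs_cis mulr1 gtr0_norm // /q; lra.
have qle y : cabs (q y) <= 2 * rho.
  by apply: (le_trans (cabsB _ _)); rewrite cabsM cabsC cabs_cis mulr1 gtr0_norm //; lra.
have q'le y : cabs (q' y) <= rho * (2 * pi).
  by rewrite /q' !cabsM -cabsM cabs_2pi_i cabsC cabs_cis mulr1 gtr0_norm.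
have sg1 x : 0 <= x <= 1 -> cabs (sg x) <= 1.
  by move=> /sg_bd hx; rewrite sgE cabsC ger0_norm; lra.
have Pa x y : 0 <= x <= 1 -> P x y - a != 0.
  by move=> hx; rewrite /P addrC addKr mulf_neq0 ?sg0.
have Pr x y : 0 <= x <= 1 -> cabs (P x y) <= rho.
  move=> hx; have h := sg_bd x hx.
  have -> : P x y = (1 - (dl + (1 - dl) * x))%:K * a + (dl + (1 - dl) * x)%:K * (rho%:K * cis y).
    by rewrite /P /q sgE rmorphB; ring.
  apply: (le_trans (cabsD _ _)); rewrite !cabsM !cabsC cabs_cis mulr1.
  rewrite !ger0_norm; [|lra..].
  set t := _ + _ in h *.
  have : 0 <= (1 - t) * (rho - cabs a) by rewrite mulr_ge0; lra.
  lra.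
have dg x y : 0 <= x <= 1 -> cdiff g (P x y).
  move=> hx; apply: cdiffM; first by apply: hf; exact: Pr.
  apply: cdiffV; first exact: Pa.
  by apply: cdiffB; [exact: cdiff_id|exact: cdiff_cst].
have dsg x : rderiv sg x (1 - dl)%:K by exact: rderiv_affine.
have dq y : rderiv q y (q' y).
  by have := rderivB (rderiv_scale rho%:K (rderiv_cis y)) (rderiv_cst a y); rewrite subr0.
have dPx x y : rderiv (P^~ y) x (Px x y).
  have := rderivD (rderiv_cst a x) (rderivM (dsg x) (rderiv_cst (q y) x)).
  by rewrite add0r mulr0 addr0.
have dPy x y : rderiv (P x) y (Py x y).
  have := rderivD (rderiv_cst a y) (rderiv_scale (sg x) (dq y)).
  by rewrite add0r.
have pi0 : 0 < pi :> R by exact: pi_gt0.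
pose M := 2 * rho + rho * (2 * pi).
have rp : 0 <= rho * (2 * pi) by rewrite mulr_ge0 // ?ltW //; lra.
have ctsx y x : 0 <= x <= 1 -> rcts (fun s => g (P s y) * Px s y) x.
  move=> hx; have [d hd] := dg x y hx; apply: rctsM; last exact: rcts_cst.
  exact: (rcts_comp (p := P^~ y) hd (rderiv_rcts (dPx x y))).
have ctsy x y : 0 <= x <= 1 -> rcts (fun t => g (P x t) * Py x t) y.
  move=> hx; have [d hd] := dg x y hx; apply: rctsM.
    exact: (rcts_comp (p := P x) hd (rderiv_rcts (dPy x y))).
  apply: rctsM; first exact: rcts_cst.
  apply: rctsM; first exact: rcts_cst.
  by apply: rctsM; [exact: rcts_cst|exact: rcts_cis].
have := @goursat_param _ g P Px Py
  (fun x y => prim (fun s => g (P s y) * Px s y) x)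
  (fun x y => prim (fun t => g (P x t) * Py x t) y) M.
(* The sides [y = 0] and [y = 1] coincide because [cis] is periodic; their contributions cancel and
   only the two circles remain. *)
have P10 s : P s 1 = P s 0 by rewrite /P /q cis0 cis1.
have -> : (fun s => g (P s 1) * Px s 1) = (fun s => g (P s 0) * Px s 0).
  by apply/funext => s; rewrite P10 /Px /q cis0 cis1.
rewrite subrr => H.
have {H} : avg (fun t => g (P 1 t) * Py 1 t) - avg (fun t => g (P 0 t) * Py 0 t) = 0.
  rewrite /avg; apply: H => x y hx hy; last first.
    by split; apply: primP => // s hs; [exact: ctsx|exact: ctsy].
  split=> //.
  - exact: dg.
  - rewrite /Px cabsM cabsC ger0_norm; last lra.
    have : 0 <= dl * cabs (q y) by rewrite mulr_ge0 ?cabs_ge0 //; lra.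
    by have := qle y; rewrite /M; lra.
  - rewrite /Py cabsM.
    have : cabs (sg x) * cabs (q' y) <= 1 * (rho * (2 * pi)) by rewrite ler_pM ?cabs_ge0 ?sg1.
    by rewrite /M; lra.
move/eqP; rewrite subr_eq0 => /eqP H.
have s1 : sg 1 = 1 by rewrite sgE mulr1 subrKC.
have s0 : sg 0 = dl%:K by rewrite sgE mulr0 addr0.
have -> : (fun y => f (rho%:K * cis y) /
    (rho%:K * cis y - a) * (rho%:K * (((2 * pi)%:C * 'i)%C * cis y))) =
   (fun t => g (P 1 t) * Py 1 t).
  by apply/funext => y; rewrite /g /Py /P s1 !mul1r /q subrKC.
rewrite H; congr avg; apply/funext => y.
rewrite /g /Py /P s0 -/(q y) -/(q' y) [X in _ / X]addrC addKr.
have d0 : dl%:K != 0 :> R[i] by rewrite -s0 sg0 // lexx ler01.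
have q00 := q0 y; field; rewrite q00 d0 //.
Qed.

Lemma kernel_bound (q : R[i]) y : cabs q < 1 ->
  1 - q * (cis y)^* != 0 /\ cabs (1 - q * (cis y)^*)^-1 <= (1 - cabs q)^-1.
Proof.
move=> q1; have h : 1 - cabs q <= cabs (1 - q * (cis y)^*).
  by have := cabs_subl 1 (q * (cis y)^*); rewrite cabs1 cabsM cabs_conj cabs_cis mulr1.
split; first by rewrite -cabs_gt0; lra.
by rewrite cabsV lef_pV2 ?posrE //; lra.
Qed.

Lemma rcts_cisV y : rcts (fun y : R => (cis y)^*) y.
Proof.
have -> : (fun y : R => (cis y)^*) = (fun y : R => (cis y)^-1).
  by apply/funext => t; rewrite cisV.
exact: (@rctsV _ (@cis R) y (cis_neq0 y) (rcts_cis y)).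
Qed.

Lemma rcts_kernel (q : R[i]) y : cabs q < 1 -> rcts (fun y => (1 - q * (cis y)^*)^-1) y.
Proof.
move=> q1; apply: (@rctsV _ (fun y => 1 - q * (cis y)^*)); first by case: (kernel_bound y q1).
apply: rctsD; first exact: rcts_cst.
have -> : (fun t => - (q * (cis t)^*)) = (fun t => - q * (cis t)^*).
  by apply/funext => t; rewrite mulNr.
by apply: rctsM; [exact: rcts_cst|exact: rcts_cisV].
Qed.

Lemma rctsX phi n (y : R) : rcts phi y -> rcts (fun y => phi y ^+ n) y.
Proof.
move=> h; elim: n => [|n IH].
  by under eq_fun do rewrite expr0; exact: rcts_cst.
have -> : (fun y => phi y ^+ n.+1) = (fun y => phi y * phi y ^+ n).
  by apply/funext => t; rewrite exprS.
exact: (rctsM h IH).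
Qed.

Lemma rcts_sum n (F : nat -> R -> R[i]) y : (forall k, rcts (F k) y) ->
  rcts (fun y => \sum_(k < n) F k y) y.
Proof.
move=> h; elim: n => [|n IH].
  by under eq_fun do rewrite big_ord0; exact: rcts_cst.
have -> : (fun y => \sum_(k < n.+1) F k y) = (fun y => \sum_(k < n) F k y + F n y).
  by apply/funext => t; rewrite big_ord_recr.
exact: (rctsD IH (h n)).
Qed.

Lemma avgZ c (phi : R -> R[i]) : (forall x, 0 <= x <= 1 -> rcts phi x) ->
  avg (fun x => c * phi x) = c * avg phi.
Proof.
move=> h; have := @avg_lin _ c 0 phi phi h h; rewrite mul0r addr0 => <-.
by congr avg; apply/funext => x; rewrite mul0r addr0.
Qed.

Lemma avgD (phi psi : R -> R[i]) :
  (forall x, 0 <= x <= 1 -> rcts phi x) -> (forall x, 0 <= x <= 1 -> rcts psi x) ->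
  avg (fun x => phi x + psi x) = avg phi + avg psi.
Proof.
move=> h1 h2; have := @avg_lin _ 1 1 phi psi h1 h2; rewrite !mul1r => <-.
by congr avg; apply/funext => x; rewrite !mul1r.
Qed.

Lemma avg_sum n (F : nat -> R -> R[i]) : (forall k x, 0 <= x <= 1 -> rcts (F k) x) ->
  avg (fun x => \sum_(k < n) F k x) = \sum_(k < n) avg (F k).
Proof.
move=> h; elim: n => [|n IH].
  rewrite big_ord0 (@avg_unique _ _ (fun=> 0)) ?subrr // => x hx.
    by rewrite big_ord0; exact: rderiv_cst.
  by under eq_fun do rewrite big_ord0; exact: rcts_cst.
have -> : (fun y => \sum_(k < n.+1) F k y) = (fun y => \sum_(k < n) F k y + F n y).
  by apply/funext => t; rewrite big_ord_recr.
rewrite avgD ?IH ?big_ord_recr //; last by move=> x hx; exact: h.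
by move=> x hx; apply: rcts_sum => k; exact: h.
Qed.

Lemma geo_kernel (w : R[i]) n : 1 - w != 0 ->
  (1 - w)^-1 = \sum_(k < n) w ^+ k + w ^+ n * (1 - w)^-1.
Proof.
move=> w0; apply: (mulIf w0); rewrite mulVf // mulrDl mulrVK ?unitfE //.
by have := subrX1 w n; set S := \sum_(i < n) _ => E; rewrite -[1 in LHS](subKr (w ^+ n)) E; ring.
Qed.

Lemma rderiv_cisV n (y : R) :
  rderiv (fun y => (cis y)^* ^+ n) y (n%:R * (((2 * pi)%:C * 'i)%C)^* * (cis y)^* ^+ n).
Proof.
elim: n => [|n IH].
  by under eq_fun do rewrite expr0; rewrite !mul0r; exact: rderiv_cst.
have dc : rderiv (fun y => (cis y)^*) y ((((2 * pi)%:C * 'i)%C)^* * (cis y)^*).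
  move=> e /(rderiv_cis y) [dl dl0 hdl]; exists dl => // h /hdl.
  set d := ((2 * pi)%:C * 'i)%C; set u := cis (y + h); set v := cis y.
  by rewrite -cabs_conj !conjB !conjM !conj_real.
have -> : (fun y : R => (cis y)^* ^+ n.+1) = (fun y => (cis y)^* * (cis y)^* ^+ n).
  by apply/funext => t; rewrite exprS.
have := rderivM dc IH; congr (rderiv _ _ _); rewrite exprS -natr1; ring.
Qed.

(** For [k > 0] a multiple of the function itself is a primitive, and it takes equal values at 0 and
    1. *)
Lemma avg_cisV k : avg (fun y : R => (cis y)^* ^+ k) = (k == 0%N)%:R.
Proof.
have c y : rcts (fun y : R => (cis y)^* ^+ k) y by apply: rctsX; exact: rcts_cisV.
case: k c => [|k] c.
  rewrite (@avg_unique _ _ (fun x => 0 + 1 * (x%:C)%C)) //; last first.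
    by move=> x _; rewrite expr0; exact: rderiv_affine.
  by rewrite !add0r !mul1r subr0.
set c0 := (((2 * pi : R)%:C * 'i)%C)^*.
have c00 : c0 != 0.
  by rewrite -cabs_gt0 cabs_conj cabs_2pi_i mulr_gt0 // pi_gt0.
rewrite (@avg_unique _ _ (fun x => (k.+1%:R * c0)^-1 * (cis x)^* ^+ k.+1)) //; last first.
  move=> x _; have := rderiv_scale (k.+1%:R * c0)^-1 (rderiv_cisV k.+1 x).
  by rewrite mulrA mulVf ?mul1r // mulf_neq0 // pnatr_eq0.
by rewrite cis0 cis1 subrr.
Qed.

End CauchyFormula.

(** * Taylor expansion with remainder and the maximum principle *)

Section Taylor.
Context {R : realType}.
Implicit Types (f : R[i] -> R[i]) (rho : R).

(** A closed disc, boundary included: this also serves functions such as [1 / h] that are known to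
    be differentiable only on a disc smaller than the unit disc. *)
Definition holc rho f := forall z, cabs z <= rho -> cdiff f z.

Lemma circle_le rho (y : R) : 0 <= rho -> cabs (rho%:K * cis y) = rho.
Proof. by move=> h; rewrite cabsM cabsC cabs_cis mulr1 ger0_norm. Qed.

Lemma rcts_holc f rho (p : R -> R[i]) y : holc rho f -> cabs (p y) <= rho -> rcts p y ->
  rcts (fun y => f (p y)) y.
Proof. by move=> hf /hf [d hd]; exact: rcts_comp hd. Qed.

Lemma rcts_circle rho (y : R) : rcts (fun y => rho%:K * cis y) y.
Proof. by apply: rctsM; [exact: rcts_cst|exact: rcts_cis]. Qed.

Lemma circle_mean_homotopy f (a : R[i]) rho dl : 0 < rho -> cabs a < rho -> 0 < dl < 1 ->
  holc rho f ->
  avg (fun y => f (rho%:K * cis y) * (1 - a / rho%:K * (cis y)^*)^-1) =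
  avg (fun y => f (a + dl%:K * (rho%:K * cis y - a)) * (1 - a / rho%:K * (cis y)^*)^-1).
Proof.
move=> rho0 ar dl01 hf; have := mean_homotopy rho0 ar dl01 hf.
have r0 : rho%:K != 0 :> R[i] by rewrite -cabs_gt0 cabsC normr_gt0 gt_eqF.
have q1 : cabs (a / rho%:K) < 1.
  by rewrite cabsM cabsV cabsC gtr0_norm // ltr_pdivrMr // mul1r.
set c := (_ * 'i)%C.
have c0 : c != 0 by rewrite -cabs_gt0 cabs_2pi_i mulr_gt0 // pi_gt0.
have E (F : R -> R[i]) : (fun y => F y / (rho%:K * cis y - a) * (rho%:K * (c * cis y))) =
    (fun y => c * (F y * (1 - a / rho%:K * (cis y)^*)^-1)).
  apply/funext => y; rewrite cisV.
  have u0 := cis_neq0 y; have [k0 _] := kernel_bound y q1; rewrite cisV in k0.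
  have : rho%:K * cis y - a = rho%:K * cis y * (1 - a / rho%:K / cis y).
    by field; rewrite u0 r0.
  move=> ->; field; rewrite u0 r0 /=.
  have -> : rho%:K * cis y - a = rho%:K * cis y * (1 - a / rho%:K / cis y).
    by field; rewrite u0 r0.
  by rewrite !mulf_neq0.
rewrite !E !avgZ; first by move/(mulfI c0).
  move=> y _; apply: rctsM; last exact: rcts_kernel.
  apply: (rcts_holc (p := fun y => a + dl%:K * (rho%:K * cis y - a)) hf).
    have -> : a + dl%:K * (rho%:K * cis y - a) = (1 - dl)%:K * a + dl%:K * (rho%:K * cis y).
      by rewrite rmorphB; ring.
    apply: (le_trans (cabsD _ _)); rewrite cabsM [cabs (dl%:K * _)]cabsM circle_le; last lra.
    rewrite !cabsC !ger0_norm; [|lra..].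
    have : 0 <= (1 - dl) * (rho - cabs a) by rewrite mulr_ge0; lra.
    lra.
  apply: rctsD; first exact: rcts_cst.
  apply: rctsM; first exact: rcts_cst.
  by apply: rctsD; [exact: rcts_circle|exact: rcts_cst].
move=> y _; apply: rctsM; last exact: rcts_kernel.
apply: (rcts_holc (p := fun y => rho%:K * cis y) hf); last exact: rcts_circle.
by rewrite circle_le //; lra.
Qed.

(** In the geometric expansion all terms of positive order have mean 0, and the remainder tends to 0
    because [|q| < 1]. *)
Lemma avg_kernel (q : R[i]) : cabs q < 1 -> avg (fun y : R => (1 - q * (cis y)^*)^-1) = 1.
Proof.
move=> q1; apply/eqP; rewrite -subr_eq0; apply/eqP.
apply: (@cabs_small_eq0 _ _ (1 - cabs q)^-1) => e e0.
have [n ne] : exists n, cabs q ^+ n < e by apply: geometric_small; rewrite ?cabs_ge0.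
have vX k y : rcts (fun y : R => (q * (cis y)^*) ^+ k) y.
  by apply: rctsX; apply: rctsM; [exact: rcts_cst|exact: rcts_cisV].
have kc y : rcts (fun y : R => (1 - q * (cis y)^*)^-1) y by exact: rcts_kernel.
have -> : (fun y : R => (1 - q * (cis y)^*)^-1) =
   (fun y => \sum_(k < n.+1) (q * (cis y)^*) ^+ k +
      (q * (cis y)^*) ^+ n.+1 * (1 - q * (cis y)^*)^-1).
  by apply/funext => y; apply: geo_kernel; case: (kernel_bound y q1).
have rc y : rcts (fun y : R => (q * (cis y)^*) ^+ n.+1 * (1 - q * (cis y)^*)^-1) y.
  by apply: rctsM; [exact: vX|exact: kc].
rewrite avgD //; last by move=> y _; apply: (@rcts_sum _ _ (fun k y => (q * (cis y)^*) ^+ k)).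
rewrite (@avg_sum _ _ (fun k y => (q * (cis y)^*) ^+ k)) // big_ord_recl big1 ?addr0; last first.
  move=> k _; have -> : (fun y : R => (q * (cis y)^*) ^+ lift ord0 k) =
      (fun y => q ^+ lift ord0 k * (cis y)^* ^+ lift ord0 k).
    by apply/funext => y; rewrite exprMn.
  rewrite avgZ ?avg_cisV ?mulr0 // => y _; apply: rctsX; exact: rcts_cisV.
have -> : (fun y : R => (q * (cis y)^*) ^+ ord0 (n' := n)) = (fun y => (cis y)^* ^+ 0).
  by apply/funext => y; rewrite !expr0.
have K1 (z : R[i]) : 1 + z - 1 = z by ring.
rewrite avg_cisV eqxx mulr1n K1.
apply: avg_bound => // y _; have [_ kb] := kernel_bound y q1.
rewrite cabsM cabsX cabsM cabs_conj cabs_cis mulr1 mulrC ler_pM ?cabs_ge0 ?exprn_ge0 ?cabs_ge0 //.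
apply: le_trans (ltW ne); rewrite exprS ler_piMl ?exprn_ge0 ?cabs_ge0 //; exact: ltW.
Qed.

(** Once the circle is shrunk towards [a], the values of [f] on it are within [e] of [f a], while
    the kernel has mean 1 and a bound independent of the shrinking. *)
Lemma cauchy_formula f (a : R[i]) rho : 0 < rho -> cabs a < rho -> holc rho f ->
  avg (fun y => f (rho%:K * cis y) * (1 - a / rho%:K * (cis y)^*)^-1) = f a.
Proof.
move=> rho0 ar hf; set q := a / rho%:K.
have q1 : cabs q < 1.
  by rewrite cabsM cabsV cabsC gtr0_norm // ltr_pdivrMr // mul1r.
apply/eqP; rewrite -subr_eq0; apply/eqP.
apply: (@cabs_small_eq0 _ _ (1 - cabs q)^-1) => e e0.
have [d0 fd] : cdiff f a by apply: hf; exact: ltW.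
have [dl dl0 hdl] := cderiv_cts fd e0.
(* The bound 1/2 ensures [t < 1]; the other one uses that the circle lies within [2 rho] of [a]. *)
pose t := Num.min (1 / 2) (dl / (4 * rho)).
have t0 : 0 < t by rewrite lt_min divr_gt0 //= divr_gt0 // mulr_gt0.
have t1 : t < 1 by rewrite gt_min; apply/orP; left; lra.
have t2 : t * (2 * rho) < dl.
  have : t <= dl / (4 * rho) by rewrite ge_min lexx orbT.
  rewrite ler_pdivlMr ?mulr_gt0 //; lra.
rewrite (@circle_mean_homotopy f a rho t) // ?t0 // -/q.
have kc y : rcts (fun y : R => (1 - q * (cis y)^*)^-1) y by exact: rcts_kernel.
have near y : cabs (t%:K * (rho%:K * cis y - a)) < dl.
  rewrite cabsM cabsC gtr0_norm //; apply: le_lt_trans t2.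
  rewrite ler_pM2l //; apply: (le_trans (cabsB _ _)); rewrite circle_le; lra.
have pc y : rcts (fun y => f (a + t%:K * (rho%:K * cis y - a)) - f a) y.
  apply: rctsD; last exact: rcts_cst.
  apply: (rcts_holc (p := fun y => a + t%:K * (rho%:K * cis y - a)) hf).
    have -> : a + t%:K * (rho%:K * cis y - a) = (1 - t)%:K * a + t%:K * (rho%:K * cis y).
      by rewrite rmorphB; ring.
    apply: (le_trans (cabsD _ _)); rewrite cabsM [cabs (t%:K * _)]cabsM circle_le; last lra.
    rewrite !cabsC !ger0_norm; [|lra..].
    have : 0 <= (1 - t) * (rho - cabs a) by rewrite mulr_ge0; lra.
    lra.
  apply: rctsD; first exact: rcts_cst.
  apply: rctsM; first exact: rcts_cst.
  by apply: rctsD; [exact: rcts_circle|exact: rcts_cst].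
have -> : (fun y => f (a + t%:K * (rho%:K * cis y - a)) * (1 - q * (cis y)^*)^-1) =
  (fun y => (f (a + t%:K * (rho%:K * cis y - a)) - f a) * (1 - q * (cis y)^*)^-1
     + f a * (1 - q * (cis y)^*)^-1).
  by apply/funext => y; ring.
rewrite avgD; first last.
- by move=> y _; apply: rctsM; [exact: rcts_cst|exact: kc].
- by move=> y _; apply: rctsM; [exact: pc|exact: kc].
rewrite avgZ // avg_kernel // mulr1 addrK.
apply: avg_bound => [y _|y _]; first by apply: rctsM; [exact: pc|exact: kc].
have [_ kb] := kernel_bound y q1.
by rewrite cabsM mulrC ler_pM ?cabs_ge0 // hdl.
Qed.

(** The [k]-th Taylor coefficient at 0, as a Cauchy integral over the circle of radius [rho]. *)
Definition tcoef f rho k : R[i] :=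
  (rho%:K)^-1 ^+ k * avg (fun y => f (rho%:K * cis y) * (cis y)^* ^+ k).

(** Expanding the Cauchy kernel to order [n] produces the coefficients [tcoef]; the remainder
    carries [q^n] and the kernel bound [1 / (1 - |q|)]. *)
Lemma taylor_bound f (a : R[i]) rho M n : 0 < rho -> cabs a < rho -> holc rho f ->
  (forall z, cabs z = rho -> cabs (f z) <= M) ->
  cabs (f a - \sum_(k < n) tcoef f rho k * a ^+ k) <= M * (cabs a / rho) ^+ n / (1 - cabs a / rho).
Proof.
move=> rho0 ar hf hM; set q := a / rho%:K.
have qE : cabs q = cabs a / rho by rewrite cabsM cabsV cabsC gtr0_norm.
have q1 : cabs q < 1 by rewrite qE ltr_pdivrMr // mul1r.
rewrite -(cauchy_formula rho0 ar hf) -/q -qE.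
have kc y : rcts (fun y : R => (1 - q * (cis y)^*)^-1) y by exact: rcts_kernel.
have fc y : rcts (fun y => f (rho%:K * cis y)) y.
  apply: (rcts_holc (p := fun y => rho%:K * cis y) hf); last exact: rcts_circle.
  by rewrite circle_le // ltW.
have vX k y : rcts (fun y : R => (q * (cis y)^*) ^+ k) y.
  by apply: rctsX; apply: rctsM; [exact: rcts_cst|exact: rcts_cisV].
have fk k y : rcts (fun y => f (rho%:K * cis y) * (q * (cis y)^*) ^+ k) y.
  by apply: rctsM; [exact: fc|exact: vX].
have -> : (fun y : R => f (rho%:K * cis y) * (1 - q * (cis y)^*)^-1) =
   (fun y => \sum_(k < n) f (rho%:K * cis y) * (q * (cis y)^*) ^+ k
     + f (rho%:K * cis y) * (q * (cis y)^*) ^+ n * (1 - q * (cis y)^*)^-1).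
  apply/funext => y; rewrite -mulr_sumr -mulrA -mulrDr; congr (_ * _).
  by apply: geo_kernel; case: (kernel_bound y q1).
have rc y : rcts (fun y : R =>
    f (rho%:K * cis y) * (q * (cis y)^*) ^+ n * (1 - q * (cis y)^*)^-1) y.
  by apply: rctsM; [exact: fk|exact: kc].
rewrite avgD //; last first.
  by move=> y _; apply: (@rcts_sum _ _ (fun k y => f (rho%:K * cis y) * (q * (cis y)^*) ^+ k)).
rewrite (@avg_sum _ _ (fun k y => f (rho%:K * cis y) * (q * (cis y)^*) ^+ k)) //.
set S := \sum_(k < n) avg _; have -> : \sum_(k < n) tcoef f rho k * a ^+ k = S.
  apply: eq_bigr => k _; rewrite /tcoef mulrAC -exprMn [_^-1 * a]mulrC -/q -avgZ.
    by congr avg; apply/funext => y; rewrite [(q * _) ^+ _]exprMn; ring.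
  by move=> y _; apply: rctsM; [exact: fc|apply: rctsX; exact: rcts_cisV].
rewrite [S + _]addrC addrK; apply: avg_bound => // y _; have [_ kb] := kernel_bound y q1.
have hy := hM (rho%:K * cis y) (circle_le y (ltW rho0)).
have M0 : 0 <= M by apply: le_trans hy; exact: cabs_ge0.
rewrite cabsM [cabs (f _ * _)]cabsM cabsX [cabs (q * _)]cabsM cabs_conj cabs_cis mulr1.
apply: ler_pM => //; rewrite ?mulr_ge0 ?exprn_ge0 ?cabs_ge0 //.
by apply: ler_wpM2r; rewrite // exprn_ge0 // cabs_ge0.
Qed.

Lemma holcX f rho m : holc rho f -> holc rho (fun z => f z ^+ m).
Proof. by move=> hf z hz; apply: cdiffX; exact: hf. Qed.

Lemma circle_bound f rho : 0 <= rho -> holc rho f ->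
  exists2 z, cabs z = rho & forall w, cabs w = rho -> cabs (f w) <= cabs (f z).
Proof.
move=> r0 hf.
have fc y : rcts (fun y => f (rho%:K * cis y)) y.
  by apply: (rcts_holc (p := fun y => rho%:K * cis y) hf); [rewrite circle_le|exact: rcts_circle].
have ct : continuous (fun y => cabs (f (rho%:K * cis y))).
  move=> y; apply/cvgrPdist_le => /= e e0; have [dl dl0 hdl] := fc y _ e0.
  exists dl => // t; rewrite /ball_ /= => yt.
  have := hdl (t - y); rewrite subrKC distrC => /(_ yt) h.
  have h1 := cabs_subl (f (rho%:K * cis y)) (f (rho%:K * cis t)).
  have h2 := cabs_subl (f (rho%:K * cis t)) (f (rho%:K * cis y)).
  by rewrite cabs_distC in h1; rewrite ler_norml; lra.
have [c _ hc] := EVT_max (@ler01 R) (continuous_subspaceT ct).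
exists (rho%:K * cis c); first exact: circle_le.
move=> w hw; have [y hy ->] := cis_polar w.
by rewrite hw; apply: hc; rewrite in_itv.
Qed.

(** The expansion with no terms gives the bound up to the factor [1 / (1 - |a| / rho)]. The same
    factor appears for every power [f^m] and its bound [M^m], so [|f a| > M] fails for large [m]. *)
Lemma max_modulus f rho M (a : R[i]) : 0 < rho -> holc rho f ->
  (forall z, cabs z = rho -> cabs (f z) <= M) -> cabs a <= rho -> cabs (f a) <= M.
Proof.
move=> rho0 hf hM; rewrite le_eqVlt => /predU1P[/hM //|ar].
have M0 : 0 <= M.
  apply: le_trans (hM rho%:K _); first exact: cabs_ge0.
  by rewrite cabsC gtr0_norm.
have q1 : cabs a / rho < 1 by rewrite ltr_pdivrMr // mul1r.
have bd m : cabs (f a) ^+ m <= M ^+ m / (1 - cabs a / rho).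
  have := @taylor_bound _ a rho (M ^+ m) 0%N rho0 ar (holcX m hf).
  rewrite big_ord0 subr0 expr0 mulr1 cabsX; apply => z hz.
  by rewrite cabsX lerXn2r ?nnegrE ?cabs_ge0 // hM.
rewrite leNgt; apply/negP => Mf.
have F0 : 0 < cabs (f a) by apply: le_lt_trans Mf.
have K0 : 0 < 1 - cabs a / rho by lra.
have [n] : exists n, (M / cabs (f a)) ^+ n < 1 - cabs a / rho.
  by apply: geometric_small; rewrite // divr_ge0 ?cabs_ge0 //= ltr_pdivrMr // mul1r.
rewrite ltNge => /negP; apply.
by rewrite expr_div_n ler_pdivlMr ?exprn_gt0 // mulrC -ler_pdivlMr.
Qed.

End Taylor.

(** * Zeros of holomorphic functions on the disc *)

Section HolDisc.
Context {R : realType}.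
Implicit Types (f g u v : R[i] -> R[i]) (rho : R) (a z w : R[i]) (s : seq R[i]).

Lemma HolP f : Hol f <-> forall z, cabs z < 1 -> cdiff f z.
Proof. by split=> h z /h /cdiffP. Qed.

Lemma Hol_cst (c : R[i]) : Hol (fun=> c).
Proof. by apply/HolP => z _; exact: cdiff_cst. Qed.
(* Hol f unfolds to a product, which would otherwise make c implicit. *)
Arguments Hol_cst : clear implicits.

Lemma Hol_id : Hol (fun z : R[i] => z).
Proof. by apply/HolP => z _; exact: cdiff_id. Qed.
Arguments Hol_id : clear implicits.

Lemma HolD f g : Hol f -> Hol g -> Hol (fun z => f z + g z).
Proof. by move=> /HolP hf /HolP hg; apply/HolP => z hz; apply: cdiffD; auto. Qed.

Lemma HolB f g : Hol f -> Hol g -> Hol (fun z => f z - g z).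
Proof. by move=> /HolP hf /HolP hg; apply/HolP => z hz; apply: cdiffB; auto. Qed.

Lemma HolM f g : Hol f -> Hol g -> Hol (fun z => f z * g z).
Proof. by move=> /HolP hf /HolP hg; apply/HolP => z hz; apply: cdiffM; auto. Qed.

Lemma HolX f n : Hol f -> Hol (fun z => f z ^+ n).
Proof. by move=> /HolP hf; apply/HolP => z hz; apply: cdiffX; auto. Qed.

Lemma HolV f : Hol f -> (forall z, cabs z < 1 -> f z != 0) -> Hol (fun z => (f z)^-1).
Proof. by move=> /HolP hf h; apply/HolP => z hz; apply: cdiffV; auto. Qed.

Lemma Hol_prod (I : Type) (r : seq I) (F : I -> R[i] -> R[i]) :
  (forall i, Hol (F i)) -> Hol (fun z => \prod_(i <- r) F i z).
Proof.
move=> h; elim: r => [|i r IH].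
  have -> : (fun z => \prod_(i <- [::]) F i z) = (fun=> 1).
    by apply/funext => z; rewrite big_nil.
  exact: Hol_cst.
have -> : (fun z => \prod_(j <- i :: r) F j z) = (fun z => F i z * \prod_(j <- r) F j z).
  by apply/funext => z; rewrite big_cons.
exact: (HolM (h i) IH).
Qed.

Lemma Hol_scale f c : Hol f -> cabs c <= 1 -> Hol (fun z => f (c * z)).
Proof.
move=> /HolP hf hc; apply/HolP => z hz.
have [d hd] : cdiff (fun w => f (0 + c * w)) z.
  apply: cdiff_affine; apply: hf; rewrite add0r cabsM.
  by apply: le_lt_trans hz; rewrite ler_piMl ?cabs_ge0.
by exists d; move: hd; congr (cderiv _ _ _); apply/funext => w; rewrite add0r.
Qed.

Lemma Hol_holc f rho : Hol f -> rho < 1 -> holc rho f.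
Proof. by move=> /HolP h r1 z hz; apply: h; exact: le_lt_trans r1. Qed.

Lemma Hol_max_modulus f rho M z : Hol f -> 0 < rho < 1 ->
  (forall w, cabs w = rho -> cabs (f w) <= M) -> cabs z <= rho -> cabs (f z) <= M.
Proof. by move=> hf /andP[r0 r1]; apply: max_modulus => //; exact: Hol_holc. Qed.

(** The delicate point is differentiability of the quotient at [a]: the second order Taylor
    expansion of [f] about [a] provides its value and derivative there. *)
Lemma Hol_divide f a : Hol f -> cabs a < 1 -> f a = 0 ->
  exists2 g, Hol g & forall z, f z = (z - a) * g z.
Proof.
move=> /HolP hf a1 fa.
pose rho := (1 - cabs a) / 2.
have r0 : 0 < rho by rewrite /rho; lra.
pose F w := f (a + 1 * w).
have hF : holc rho F.
  move=> w hw; apply: cdiff_affine; apply: hf; rewrite mul1r.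
  by apply: (le_lt_trans (cabsD _ _)); rewrite /rho in hw r0; lra.
have [w0 _ hM] := circle_bound (ltW r0) hF.
pose c k := tcoef F rho k; pose M := cabs (F w0).
(* The factor 2 bounds [1 / (1 - |h| / rho)]. *)
have T h : cabs h < rho / 2 ->
    cabs (f (a + h) - (c 0%N + c 1%N * h + c 2%N * h ^+ 2)) <= 2 * M / rho ^+ 3 * cabs h ^+ 3.
  move=> hh; have hr : cabs h < rho by lra.
  have := taylor_bound 3 r0 hr hF hM.
  rewrite !big_ord_recl big_ord0 /= expr0 mulr1 expr1 addr0 addrA /F mul1r => /le_trans; apply.
  have q1 : cabs h / rho <= 1 / 2 by rewrite ler_pdivrMr //; lra.
  rewrite expr_div_n -/M.
  have -> : 2 * M / rho ^+ 3 * cabs h ^+ 3 = M * (cabs h ^+ 3 / rho ^+ 3) * 2.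
    by field; rewrite gt_eqF.
  apply: ler_wpM2l; first by rewrite !mulr_ge0 ?exprn_ge0 ?invr_ge0 ?exprn_ge0 ?cabs_ge0 // ltW.
  by rewrite -[leRHS]invrK lef_pV2 ?posrE ?invr_gt0 //; lra.
have c0 : c 0%N = 0.
  have r2 : 0 < rho / 2 by rewrite divr_gt0.
  have := T 0; rewrite cabs0 addr0 fa (expr0n _ 2) (expr0n _ 3) /= !mulr0 !addr0 sub0r cabsN.
  by move/(_ r2) => h; apply/eqP; rewrite -cabs_eq0 eq_le h cabs_ge0.
rewrite c0 in T.
pose g z := if z == a then c 1%N else f z / (z - a).
exists g; last first.
  move=> z; rewrite /g; case: eqVneq => [->|za]; first by rewrite subrr mul0r.
  by rewrite mulrC divfK // subr_eq0.
apply/HolP => z z1; have [->|za] := eqVneq z a.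
  exists (c 2%N) => e e0; pose K := 2 * M / rho ^+ 3.
  have K0 : 0 <= K.
    apply: divr_ge0; last exact: exprn_ge0 (ltW r0).
    by apply: mulr_ge0 => //; exact: cabs_ge0.
  have K1 : 0 < K + 1 by lra.
  exists (Num.min (rho / 2) (e / (K + 1))).
    by rewrite lt_min; apply/andP; split; apply: divr_gt0.
  move=> h; rewrite lt_min => /andP[/T hT]; rewrite ltr_pdivlMr // => he.
  have ah : (a + h == a) = (h == 0) by rewrite -subr_eq0 addrAC subrr add0r.
  rewrite /g eqxx [a + h - a]addrC addKr ah; case: eqVneq => [->|h0].
    by rewrite subrr mulr0 subr0 cabs0 mulr0.
  have H0 : 0 < cabs h by rewrite cabs_gt0.
  rewrite -(ler_pM2r H0) -cabsM.
  have -> : (f (a + h) / h - c 1%N - c 2%N * h) * h = f (a + h) - (0 + c 1%N * h + c 2%N * h ^+ 2).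
    by field.
  apply: (le_trans hT); rewrite -/K.
  have -> : K * cabs h ^+ 3 = (K * cabs h) * cabs h * cabs h by ring.
  rewrite ler_pM2r // ler_pM2r //; have := mulr_ge0 K0 (ltW H0); lra.
have d0 : 0 < cabs (z - a) by rewrite cabs_gt0 subr_eq0.
apply: (@cdiff_near _ (fun w => f w / (w - a)) g z _ d0).
  move=> w; rewrite /g; case: eqVneq => [->|//].
  by rewrite cabs_distC ltxx.
apply: cdiffM; first exact: hf.
apply: cdiffV; first by rewrite subr_eq0.
by apply: cdiffB; [exact: cdiff_id|exact: cdiff_cst].
Qed.

(** This compares numerator and denominator of the Blaschke factor of the disc of radius [rho]: the
    difference vanishes for [z] on the circle and is positive when both points lie inside. *)
Lemma blaschke_identity (a z : R[i]) rho :
  cabs ((rho ^+ 2)%:K - a^* * z) ^+ 2 - (rho * cabs (z - a)) ^+ 2 =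
  (rho ^+ 2 - cabs a ^+ 2) * (rho ^+ 2 - cabs z ^+ 2).
Proof.
rewrite exprMn !cabs_sqr; case: a => a1 a2; case: z => z1 z2 /=; ring.
Qed.

Lemma blaschke_circle a z rho : 0 <= rho -> cabs z = rho ->
  cabs ((rho ^+ 2)%:K - a^* * z) = rho * cabs (z - a).
Proof.
move=> r0 hz; have := blaschke_identity a z rho.
rewrite hz subrr mulr0 => /eqP; rewrite subr_eq0 => /eqP h.
by apply/eqP; rewrite -(eqrXn2 (n := 2)) ?h ?mulr_ge0 ?cabs_ge0.
Qed.

Lemma blaschke_le1 a z : cabs a <= 1 -> cabs z <= 1 -> cabs (z - a) <= cabs (1 - a^* * z).
Proof.
move=> a1 z1; have := blaschke_identity a z 1; rewrite expr1n mul1r => h.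
have sq w : cabs w <= 1 -> 0 <= 1 - cabs w ^+ 2.
  by move=> w1; rewrite subr_ge0 exprn_ile1 ?cabs_ge0.
rewrite -(@ler_pXn2r _ 2) ?nnegrE ?cabs_ge0 // -subr_ge0 h.
by rewrite mulr_ge0 ?sq.
Qed.

Lemma blaschke_den_neq0 a z : cabs a < 1 -> cabs z <= 1 -> 1 - a^* * z != 0.
Proof.
move=> a1 z1; rewrite -cabs_gt0; have := cabs_subl 1 (a^* * z).
rewrite cabs1 cabsM cabs_conj; have : cabs a * cabs z <= cabs a by rewrite ler_piMr ?cabs_ge0.
by lra.
Qed.

(** On the smaller disc the right-hand side of [blaschke_identity] is at least [d^2], whereas the
    denominator of the Blaschke factor is at most [2 rho'^2]. The quotient [t] of [d^2] by the
    square of that bound gives [k = sqrt (1 - t)]. *)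
Lemma blaschke_contraction rho rho' : 0 <= rho < rho' ->
  exists2 k, 0 <= k < 1 & forall a z, cabs a <= rho -> cabs z <= rho ->
    rho' * cabs (z - a) <= k * cabs ((rho' ^+ 2)%:K - a^* * z).
Proof.
move=> /andP[r0 rr']; have r'0 : 0 < rho' by lra.
have r2 : 0 < rho' ^+ 2 by rewrite exprn_gt0.
have rr2 : rho ^+ 2 < rho' ^+ 2 by rewrite ltrXn2r ?nnegrE //; lra.
have sq0 : 0 <= rho ^+ 2 by rewrite exprn_ge0.
pose d := rho' ^+ 2 - rho ^+ 2.
pose t := d ^+ 2 / (2 * rho' ^+ 2) ^+ 2.
have t0 : 0 < t by rewrite divr_gt0 ?exprn_gt0 ?mulr_gt0 // /d; lra.
have t1 : t <= 1.
  by rewrite ler_pdivrMr ?exprn_gt0 ?mulr_gt0 // mul1r /d; apply: lerXn2r; rewrite ?nnegrE; lra.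
exists (Num.sqrt (1 - t)).
  by rewrite sqrtr_ge0 /= -[ltRHS]sqrtr1 ltr_sqrt //; lra.
move=> a z ha hz; have h := blaschke_identity a z rho'.
have a2 : cabs a ^+ 2 <= rho ^+ 2 by rewrite lerXn2r ?nnegrE ?cabs_ge0.
have z2 : cabs z ^+ 2 <= rho ^+ 2 by rewrite lerXn2r ?nnegrE ?cabs_ge0.
set D := cabs (_%:K - _) in h *.
rewrite -(@ler_pXn2r _ 2) ?nnegrE ?mulr_ge0 ?sqrtr_ge0 ?cabs_ge0 ?(ltW r'0) //.
rewrite [in leRHS]exprMn sqr_sqrtr; last lra.
have D2 : D <= 2 * rho' ^+ 2.
  apply: (le_trans (cabsB _ _)); rewrite cabsC ger0_norm ?cabsM ?cabs_conj; last exact: ltW.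
  have : cabs a * cabs z <= rho' * rho' by rewrite ler_pM ?cabs_ge0 //; lra.
  by rewrite -expr2; lra.
have D3 : t * D ^+ 2 <= d ^+ 2.
  rewrite /t mulrAC ler_pdivrMr ?exprn_gt0 ?mulr_gt0 // ler_wpM2l ?exprn_ge0 //.
    by rewrite /d; lra.
  by rewrite lerXn2r ?nnegrE ?cabs_ge0 // mulr_ge0 // ltW.
have : d ^+ 2 <= (rho' ^+ 2 - cabs a ^+ 2) * (rho' ^+ 2 - cabs z ^+ 2).
  by rewrite /d [leLHS]expr2; apply: ler_pM; lra.
lra.
Qed.

(** Each factor [w - a] is traded for the reflected factor [(rho^2 - a^* w) / rho], of the same
    modulus on the circle. The boundary bound [M] is thus kept, while at [z] every trade gains a
    factor [k]. *)
Lemma product_decay s g rho M k z : Hol g -> 0 < rho < 1 -> cabs z <= rho -> 0 <= k ->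
  (forall a, a \in s -> rho * cabs (z - a) <= k * cabs ((rho ^+ 2)%:K - a^* * z)) ->
  (forall w, cabs w = rho -> cabs (\prod_(a <- s) (w - a) * g w) <= M) ->
  cabs (\prod_(a <- s) (z - a) * g z) <= k ^+ size s * M.
Proof.
move=> hg r01 hz k0; have /andP[r0 r1] := r01.
elim: s g hg => [|a s IH] g hg hk hM.
  rewrite big_nil mul1r expr0 mul1r; apply: Hol_max_modulus hz => // w /hM.
  by rewrite big_nil mul1r.
pose g' w := g w * ((rho ^+ 2)%:K - a^* * w) * (rho%:K)^-1.
have hg' : Hol g'.
  have h1 := HolB (Hol_cst (rho ^+ 2)%:K) (HolM (Hol_cst a^*) Hol_id).
  exact (HolM (HolM hg h1) (Hol_cst (rho%:K)^-1)).
have E w : cabs (\prod_(b <- s) (w - b) * g' w) =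
    cabs (\prod_(b <- s) (w - b) * g w) * (cabs ((rho ^+ 2)%:K - a^* * w) / rho).
  by rewrite /g' !mulrA !cabsM cabsV cabsC gtr0_norm // !mulrA.
have E' w : cabs (\prod_(b <- a :: s) (w - b) * g w) =
    cabs (\prod_(b <- s) (w - b) * g w) * cabs (w - a).
  by rewrite big_cons -mulrA cabsM mulrC.
have H : cabs (\prod_(b <- s) (z - b) * g' z) <= k ^+ size s * M.
  apply: (IH g' hg') => [b bs|w hw]; first by apply: hk; rewrite inE bs orbT.
  rewrite E blaschke_circle //; last exact: ltW.
  by rewrite [rho * _]mulrC mulfK ?gt_eqF // -E' hM.
rewrite E' /= exprS -mulrA; apply: le_trans (ler_wpM2l k0 H); rewrite E mulrCA.
apply: ler_wpM2l; first exact: cabs_ge0.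
by rewrite mulrA ler_pdivlMr // mulrC hk // mem_head.
Qed.

(** By [product_decay], a factorization with [m] zeros forces [|f z| <= k^m M], which fails for
    large [m] since [f z] is not 0. Zeros are counted with multiplicity: [s] may contain
    repetitions. *)
Lemma zero_count f z rho : Hol f -> cabs z < 1 -> f z != 0 -> rho < 1 ->
  exists N, forall s g, Hol g -> (forall a, a \in s -> cabs a <= rho) ->
    (forall w, cabs w < 1 -> f w = \prod_(a <- s) (w - a) * g w) -> (size s <= N)%N.
Proof.
move=> hf z1 fz r1.
pose r := Num.max rho (cabs z); pose r' := (1 + r) / 2.
have rr : rho <= r by rewrite le_max lexx.
have rz : cabs z <= r by rewrite le_max lexx orbT.
have r0 : 0 <= r by exact: le_trans (cabs_ge0 _) rz.
have lt1 : r < 1 by rewrite gt_max r1.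
have h01 : 0 < r' < 1 by rewrite /r'; lra.
have [|k /andP[k0 k1] hk] := @blaschke_contraction r r'; first by rewrite /r'; lra.
have r'0 : 0 <= r' by rewrite /r'; lra.
have [w0 _ hM] := circle_bound r'0 (Hol_holc hf (proj2 (andP h01))).
set M := cabs (f w0) in hM.
have M0 : 0 <= M by exact: cabs_ge0.
have F0 : 0 < cabs (f z) by rewrite cabs_gt0.
have [n hn] : exists n, k ^+ n < cabs (f z) / (M + 1).
  by apply: geometric_small; rewrite ?k0 // divr_gt0 //; lra.
exists n => s g hg hs E; rewrite leqNgt; apply/negP => ns.
have zr' : cabs z <= r' by rewrite /r'; lra.
have := @product_decay s g r' M k z hg h01 zr' k0; rewrite -E // => H.
have : cabs (f z) <= k ^+ size s * M.
  apply: H => [a /hs ha|w hw]; first by apply: hk => //; exact: le_trans rr.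
  by rewrite -E ?hM // hw; case/andP: h01.
apply/negP; rewrite -ltNge.
move: hn; rewrite ltr_pdivlMr; last lra.
apply: le_lt_trans; apply: ler_pM => //; [exact: exprn_ge0| |lra].
by apply: ler_wiXn2l => //; [exact: ltW|exact: ltnW].
Qed.

(** Zeros in [Z] are divided out one at a time, and [zero_count] stops the process. [Z] is later
    taken to be a closed disc or a single point. *)
Lemma zero_factor f z rho (Z : R[i] -> Prop) : Hol f -> cabs z < 1 -> f z != 0 -> rho < 1 ->
  (forall a, Z a -> cabs a <= rho) ->
  exists s g, [/\ Hol g, forall a, a \in s -> Z a,
    forall w, cabs w < 1 -> f w = \prod_(a <- s) (w - a) * g w &
    forall a, Z a -> g a != 0].
Proof.
move=> hf z1 fz r1 hZ.
have [N hN] := zero_count hf z1 fz r1.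
apply: contrapT => H.
have step n : exists s g, [/\ Hol g, forall a, a \in s -> Z a,
    forall w, cabs w < 1 -> f w = \prod_(a <- s) (w - a) * g w & size s = n].
  elim: n => [|n [s [g [hg hs E sn]]]].
    by exists [::], f; split=> // w _; rewrite big_nil mul1r.
  have [a [Za ga]] : exists a, Z a /\ g a = 0.
    apply: contrapT => H2; apply: H; exists s, g; split=> // a Za.
    by apply/eqP => ga; apply: H2; exists a.
  have [g' hg' gE] := Hol_divide hg (le_lt_trans (hZ _ Za) r1) ga.
  exists (a :: s), g'; split=> //.
  - by move=> b; rewrite inE => /predU1P[->|/hs].
  - by move=> w w1; rewrite E // big_cons gE mulrCA mulrA.
  - by rewrite /= sn.
have [s [g [hg hs E sN]]] := step N.+1.
have := hN s g hg (fun a ha => hZ a (hs a ha)) E.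
by rewrite sN ltnn.
Qed.

Lemma uniq_zeros_factor f s : Hol f -> uniq s -> (forall a, a \in s -> cabs a < 1 /\ f a = 0) ->
  exists2 g, Hol g & forall z, f z = \prod_(a <- s) (z - a) * g z.
Proof.
elim: s f => [|a s IH] f hf.
  by move=> _ _; exists f => // z; rewrite big_nil mul1r.
move=> /= /andP[as_ us] hs; have [a1 fa] := hs a (mem_head _ _).
have [f1 hf1 fE] := Hol_divide hf a1 fa.
have [b bs|g hg gE] := IH f1 hf1 us.
  have [|b1] := hs b; first by rewrite inE bs orbT.
  rewrite fE => /eqP; rewrite mulf_eq0 subr_eq0 => /orP[/eqP ba|/eqP //].
  by rewrite -ba bs in as_.
by exists g => // z; rewrite fE gE big_cons mulrA.
Qed.

(** Finite lists of distinct zeros replace an accumulation point: long ones contradict [zero_count]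
    at any point where [f] is not 0. *)
Lemma identity_theorem f rho : Hol f -> rho < 1 ->
  (forall n, exists s, [/\ uniq s, size s = n & forall a, a \in s -> cabs a <= rho /\ f a = 0]) ->
  forall z, cabs z < 1 -> f z = 0.
Proof.
move=> hf r1 H z z1; apply/eqP/negPn/negP => fz.
have [N hN] := zero_count hf z1 fz r1.
have [s [us sN hs]] := H N.+1.
have [|g hg gE] := uniq_zeros_factor hf us.
  by move=> a /hs [ha ->]; split=> //; exact: le_lt_trans r1.
have := hN s g hg (fun a ha => (hs a ha).1) (fun w _ => gE w).
by rewrite sN ltnn.
Qed.

End HolDisc.

Arguments Hol_cst : clear implicits.
Arguments Hol_id : clear implicits.

(** * Quotients and the Schwarz-Pick lemma *)

Section Schwarz.
Context {R : realType}.
Implicit Types (f g u v F : R[i] -> R[i]) (rho r : R) (a z w : R[i]) (s : seq R[i]).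

Lemma dominated_at f g a : Hol f -> Hol g -> cabs a < 1 ->
  (forall z, cabs z < 1 -> z != a -> cabs (g z) <= cabs (f z)) -> cabs (g a) <= cabs (f a).
Proof.
move=> /HolP hf /HolP hg a1 H; apply/ler_addgt0Pr => e e0.
have e2 : 0 < e / 2 by rewrite divr_gt0.
have [df fd] := hf a a1; have [d1 d10 h1] := cderiv_cts fd e2.
have [dg gd] := hg a a1; have [d2 d20 h2] := cderiv_cts gd e2.
pose t := Num.min (Num.min d1 d2) (1 - cabs a) / 2.
have m0 : 0 < Num.min (Num.min d1 d2) (1 - cabs a) by rewrite !lt_min d10 d20 subr_gt0.
have t0 : 0 < t by rewrite divr_gt0.
have : t < Num.min (Num.min d1 d2) (1 - cabs a) by rewrite /t; lra.
rewrite !lt_min -andbA => /and3P[t1 t2 t3].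
have ct : cabs t%:K = t by rewrite cabsC gtr0_norm.
have {}h1 := h1 t%:K; rewrite ct in h1; have {}h1 := h1 t1.
have {}h2 := h2 t%:K; rewrite ct in h2; have {}h2 := h2 t2.
have n1 : cabs (a + t%:K) < 1 by apply: (le_lt_trans (cabsD _ _)); rewrite ct; lra.
have n2 : a + t%:K != a.
  by rewrite -subr_eq0 addrAC subrr add0r -cabs_gt0 ct.
have h := H _ n1 n2.
have h3 := cabs_subl (g a) (g (a + t%:K)); rewrite cabs_distC in h3.
have h4 := cabs_subl (f (a + t%:K)) (f a).
lra.
Qed.

(** A zero [b] of the majorant is a zero of [g], so both are divided by [z - b]; at [b] itself the
    inequality is recovered by continuity. *)
Lemma dominated_divide s u g : Hol u -> Hol g -> (forall b, b \in s -> cabs b < 1) ->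
  (forall z, cabs z < 1 -> cabs (g z) <= cabs (\prod_(b <- s) (z - b) * u z)) ->
  exists v, [/\ Hol v, forall z, cabs z < 1 -> g z = \prod_(b <- s) (z - b) * v z &
                forall z, cabs z < 1 -> cabs (v z) <= cabs (u z)].
Proof.
move=> hu; elim: s g => [|b s IH] g hg hs H.
  by exists g; split=> // z z1; [rewrite big_nil mul1r|have := H z z1; rewrite big_nil mul1r].
have b1 : cabs b < 1 by apply: hs; exact: mem_head.
have gb : g b = 0.
  apply/eqP; rewrite -cabs_eq0 eq_le cabs_ge0 andbT.
  by have := H b b1; rewrite big_cons subrr !mul0r cabs0.
have [g1 hg1 gE] := Hol_divide hg b1 gb.
have hp : Hol (fun z => \prod_(b <- s) (z - b) * u z).
  exact: (HolM (@Hol_prod _ _ s (fun b z => z - b) (fun b => HolB (Hol_id R) (Hol_cst R b))) hu).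
have [||v [hv vE vu]] := IH g1 hg1.
- by move=> c cs; apply: hs; rewrite inE cs orbT.
- move=> z z1; have ne w : cabs w < 1 -> w != b ->
      cabs (g1 w) <= cabs (\prod_(b <- s) (w - b) * u w).
    move=> w1 wb; have := H w w1; rewrite gE big_cons -mulrA !cabsM ler_pM2l //.
    by rewrite cabs_gt0 subr_eq0.
  by have [->|zb] := eqVneq z b; [exact: (dominated_at hp hg1 b1 ne)|exact: ne].
by exists v; split=> // z z1; rewrite gE vE // big_cons mulrA.
Qed.

(** The zeros of [f] are removable singularities of [g / f]. At each [a] the factors [z - a] are
    removed from both functions, leaving [u] and [v] with [u a != 0], and the quotient takes the
    value [v a / u a]. *)
Lemma Hol_quotient f g z0 : Hol f -> Hol g -> cabs z0 < 1 -> f z0 != 0 ->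
  (forall z, cabs z < 1 -> cabs (g z) <= cabs (f z)) ->
  exists phi, [/\ Hol phi, forall z, cabs z < 1 -> g z = f z * phi z &
                  forall z, cabs z < 1 -> cabs (phi z) <= 1].
Proof.
move=> hf hg z01 fz0 gf.
have loc a : exists p : (R[i] -> R[i]) * (R[i] -> R[i]), cabs a < 1 ->
    [/\ Hol p.1, Hol p.2, p.1 a != 0, cabs (p.2 a) <= cabs (p.1 a) &
        (forall z, cabs z < 1 -> g z * p.1 z = f z * p.2 z) /\
        (forall z, cabs z < 1 -> z != a -> p.1 z != 0 -> f z != 0)].
  have [a1|] := boolP (cabs a < 1); last by exists (f, f).
  have [s [u [hu hs fE ua]]] := @zero_factor _ f z0 (cabs a) (fun b => b = a) hf z01 fz0 a1
     (fun b ba => eq_ind_r (fun b => cabs b <= cabs a) (lexx _) ba).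
  have [||v [hv gE vu]] := @dominated_divide s u g hu hg.
  - by move=> b /hs ->.
  - by move=> z z1; rewrite -fE // gf.
  exists (u, v) => _; split=> //=; [exact: ua|exact: vu|split=> z z1].
    by rewrite gE // fE //; ring.
  move=> za uz; rewrite fE // mulf_neq0 // prodf_seq_neq0; apply/allP => b /hs -> /=.
  by rewrite subr_eq0.
have [p hp] := choice loc.
(* The pair [p a] varies with the point; [phi] is differentiable because near [a] it agrees with the
   single quotient attached to [a]. *)
pose phi a := (p a).2 a / (p a).1 a.
have phiE z : cabs z < 1 -> g z = f z * phi z.
  move=> z1; have [_ _ u0 _ [E _]] := hp z z1.
  by apply: (mulIf u0); rewrite E // /phi -mulrA divfK.
exists phi; split; [|exact: phiE|].
- apply/HolP => a a1; have [/HolP hu /HolP hv u0 _ [E nz]] := hp a a1.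
  have [d ud] := hu a a1.
  have U0 : 0 < cabs ((p a).1 a) / 2 by rewrite divr_gt0 // cabs_gt0.
  have [dl dl0 hdl] := cderiv_cts ud U0.
  have m0 : 0 < Num.min dl (1 - cabs a) by rewrite lt_min dl0 subr_gt0.
  apply: (@cdiff_near _ (fun w => (p a).2 w / (p a).1 w) phi a _ m0).
    move=> w; rewrite lt_min => /andP[w1 w2].
    have [->//|wa] := eqVneq w a.
    have wd : cabs w < 1.
      by have := cabsD (w - a) a; rewrite subrK; lra.
    have uw : (p a).1 w != 0.
      rewrite -cabs_gt0; have := hdl _ w1; rewrite subrKC.
      by have := cabs_subl ((p a).1 a) ((p a).1 w); rewrite cabs_distC; lra.
    have fw := nz w wd wa uw.
    apply: (mulfI fw); rewrite -phiE // mulrA -E // mulfK //.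
  by apply: cdiffM; [exact: hv|apply: cdiffV => //; exact: hu].
- move=> z z1; have [_ _ u0 vu _] := hp z z1.
  by rewrite /phi cabsM cabsV ler_pdivrMr ?cabs_gt0 // mul1r.
Qed.

(** [H] is the quotient of [F] by the Blaschke factor at [a]. On circles close to the unit circle
    [|H|^2] is at most [1 + e], and the maximum principle carries this inside. *)
Lemma schwarz_pick F a : Hol F -> (forall z, cabs z < 1 -> cabs (F z) <= 1) ->
  cabs a < 1 -> F a = 0 ->
  exists H, [/\ Hol H, forall z, cabs z < 1 -> cabs (H z) <= 1 &
    forall z, F z * (1 - a^* * z) = (z - a) * H z].
Proof.
move=> hF F1 a1 Fa; have [g hg gE] := Hol_divide hF a1 Fa.
exists (fun z => g z * (1 - a^* * z)).
have hH : Hol (fun z => g z * (1 - a^* * z)).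
  exact: (HolM hg (HolB (Hol_cst R 1) (HolM (Hol_cst R a^*) (Hol_id R)))).
split=> // [z z1|z]; last by rewrite gE; ring.
rewrite -(@ler_pXn2r _ 2) ?nnegrE ?cabs_ge0 // expr1n.
apply/ler_addgt0Pr => e e0.
pose b := (1 - cabs a) / 2; have b0 : 0 < b by rewrite /b; lra.
(* The three terms make the circle enclose [z], keep it at distance at least [b] from [a], and give
   [1 - rho^2 <= e b^2]. *)
pose rho := Num.max (Num.max (cabs z) ((1 + cabs a) / 2)) (1 - e * b ^+ 2 / 2).
have eb : 0 < e * b ^+ 2 by rewrite mulr_gt0 // exprn_gt0.
have c0 := cabs_ge0 a.
have rho1 : rho < 1 by rewrite !gt_max z1 /=; apply/andP; split; lra.
have : rho <= rho by [].
rewrite {1}/rho !ge_max -andbA => /and3P[rz ra re].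
have rho0 : 0 < rho by lra.
have r01 : 0 < rho < 1 by rewrite rho0.
have Q := @Hol_max_modulus _ _ rho (1 + e) z (@HolX _ _ 2 hH) r01.
rewrite -cabsX; apply: (Q _ rz) => {Q}.
move=> w hw; have w1 : cabs w < 1 by rewrite hw.
have bw : b <= cabs (w - a).
  by have := cabs_subl w a; rewrite hw /b; lra.
have W0 : 0 < cabs (w - a) by lra.
have h := blaschke_identity a w 1; rewrite expr1n mul1r hw in h.
have Fw : cabs (w - a) * cabs (g w) <= 1 by rewrite -cabsM -gE F1.
rewrite cabsX cabsM exprMn.
have -> : cabs (1 - a^* * w) ^+ 2 = cabs (w - a) ^+ 2 + (1 - cabs a ^+ 2) * (1 - rho ^+ 2).
  by rewrite -h; ring.
rewrite mulrDr; apply: lerD.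
  by rewrite -exprMn mulrC exprn_ile1 // mulr_ge0 ?cabs_ge0.
have gb : cabs (g w) ^+ 2 * b ^+ 2 <= 1.
  rewrite -exprMn; apply: exprn_ile1.
    by apply: mulr_ge0; [exact: cabs_ge0|exact: ltW].
  by apply: le_trans Fw; rewrite mulrC ler_wpM2r ?cabs_ge0.
have q1 : 0 <= (1 - cabs a ^+ 2) <= 1.
  by rewrite subr_ge0 exprn_ile1 ?cabs_ge0 ?(ltW a1) //= gerBl exprn_ge0.
have q2 : 0 <= 1 - rho ^+ 2 <= e * b ^+ 2.
  have -> : 1 - rho ^+ 2 = (1 - rho) * (1 + rho) by ring.
  apply/andP; split; first by apply: mulr_ge0; lra.
  have : (1 - rho) * (1 + rho) <= (1 - rho) * 2 by apply: ler_wpM2l; lra.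
  lra.
have q3 : (1 - cabs a ^+ 2) * (1 - rho ^+ 2) <= e * b ^+ 2.
  have [/andP[? ?] /andP[? ?]] := (q1, q2).
  by rewrite -[leRHS]mul1r ler_pM.
apply: (@le_trans _ _ (cabs (g w) ^+ 2 * (e * b ^+ 2))).
  by apply: ler_wpM2l => //; exact: exprn_ge0 (cabs_ge0 _).
by rewrite mulrCA -[leRHS]mulr1 ler_pM2l.
Qed.

Lemma schwarz_pick_le F a z : Hol F -> (forall z, cabs z < 1 -> cabs (F z) <= 1) ->
  cabs a < 1 -> F a = 0 -> cabs z < 1 -> cabs (F z) * cabs (1 - a^* * z) <= cabs (z - a).
Proof.
move=> hF F1 a1 Fa z1; have [H [_ H1 HE]] := schwarz_pick hF F1 a1 Fa.
by rewrite -cabsM HE cabsM ler_piMr ?cabs_ge0 ?H1.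
Qed.

Lemma moebius_Hol F b : Hol F -> (forall z, cabs z < 1 -> cabs (F z) <= 1) -> cabs b < 1 ->
  Hol (fun z => (F z - b) / (1 - b^* * F z)) /\
  forall z, cabs z < 1 -> cabs ((F z - b) / (1 - b^* * F z)) <= 1.
Proof.
move=> hF F1 b1.
have d0 z : cabs z < 1 -> 1 - b^* * F z != 0.
  by move=> /F1; exact: blaschke_den_neq0.
split.
  exact: (HolM (HolB hF (Hol_cst R b)) (HolV (HolB (Hol_cst R 1) (HolM (Hol_cst R b^*) hF)) d0)).
move=> z z1; rewrite cabsM cabsV ler_pdivrMr ?cabs_gt0 ?d0 // mul1r.
by apply: blaschke_le1; [exact: ltW|exact: F1].
Qed.

(** [schwarz_pick_le] for [F] followed by the disc automorphism sending [F a] to 0, with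
    denominators cleared. *)
Lemma schwarz_pick_pair F a z : Hol F -> (forall z, cabs z < 1 -> cabs (F z) <= 1) ->
  cabs a < 1 -> cabs z < 1 -> cabs (F a) < 1 ->
  cabs (F z - F a) * cabs (1 - a^* * z) <= cabs (z - a) * cabs (1 - (F a)^* * F z).
Proof.
move=> hF F1 a1 z1 Fa1; have [hG G1] := moebius_Hol hF F1 Fa1.
have := @schwarz_pick_le _ a z hG G1 a1 _ z1.
rewrite subrr mul0r cabsM cabsV => /(_ erefl).
have d0 : 0 < cabs (1 - (F a)^* * F z).
  by rewrite cabs_gt0 blaschke_den_neq0 ?F1.
by rewrite mulrAC ler_pdivrMr.
Qed.

(** [schwarz_pick_pair] requires a value of modulus less than 1, so it is applied to [t F] with [t]
    tending to 1. In the limit [|F z - 1| A <= |F z - 1| B], where [B < A]; hence [F z = 1]. *)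
Lemma strong_maximum F a : Hol F -> (forall z, cabs z < 1 -> cabs (F z) <= 1) ->
  cabs a < 1 -> F a = 1 -> forall z, cabs z < 1 -> F z = 1.
Proof.
move=> hF F1 a1 Fa z z1.
set A := cabs (1 - a^* * z); set B := cabs (z - a).
have BA : B < A.
  have := blaschke_identity a z 1; rewrite expr1n mul1r -/A -/B => h.
  have : 0 < (1 - cabs a ^+ 2) * (1 - cabs z ^+ 2).
    by apply: mulr_gt0; rewrite subr_gt0 exprn_ilt1 ?cabs_ge0.
  rewrite -h subr_gt0 ltr_pXn2r ?nnegrE ?cabs_ge0 //.
have key t : 0 < t < 1 -> t * cabs (F z - 1) * A <= B * (cabs (F z - 1) + 2 * (1 - t)).
  move=> /andP[t0 t1].
  have ht : Hol (fun z => t%:K * F z) by exact: (HolM (Hol_cst R t%:K) hF).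
  have ct : cabs t%:K = t by rewrite cabsC gtr0_norm.
  have h1 w : cabs w < 1 -> cabs (t%:K * F w) <= 1.
    move=> /F1 Fw; rewrite cabsM ct; apply: mulr_ile1 => //; try exact: ltW.
    exact: cabs_ge0.
  have h2 : cabs (t%:K * F a) < 1 by rewrite Fa mulr1 ct.
  have := schwarz_pick_pair ht h1 a1 z1 h2.
  rewrite Fa mulr1 -/A -/B conj_real -{2}[t%:K]mulr1 -mulrBr cabsM ct => /le_trans; apply.
  apply: ler_wpM2l; first exact: cabs_ge0.
  have -> : 1 - t%:K * (t%:K * F z) = - (F z - 1) + (1 - t ^+ 2)%:K * F z.
    by rewrite rmorphB rmorphXn rmorph1; ring.
  apply: (le_trans (cabsD _ _)); rewrite cabsN lerD2l cabsM cabsC.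
  have tt : 1 - t ^+ 2 = (1 - t) * (1 + t) by ring.
  have p0 : 0 <= 1 - t ^+ 2 by rewrite tt; apply: mulr_ge0; lra.
  rewrite ger0_norm //; apply: (@le_trans _ _ (1 - t ^+ 2)).
    by rewrite ler_piMr ?F1.
  by rewrite tt mulrC; apply: ler_wpM2r; lra.
apply/eqP; rewrite -subr_eq0; apply/eqP.
have A0 : 0 < A by apply: le_lt_trans BA; exact: cabs_ge0.
have B0 : 0 <= B by exact: cabs_ge0.
set x := cabs (F z - 1) in key.
have x0 : 0 <= x by exact: cabs_ge0.
suff : x * (A - B) <= 0.
  rewrite pmulr_lle0; last lra.
  by move=> xle; apply/eqP; rewrite -cabs_eq0 eq_le xle x0.
apply/ler_addgt0Pr => e e0; rewrite add0r.
pose K := x * A + 2 * B + 1.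
have K0 : 0 < K by have := mulr_ge0 x0 (ltW A0); rewrite /K; lra.
pose t := Num.min (1 / 2) (e / K).
have t0 : 0 < t by rewrite lt_min; apply/andP; split; [lra|exact: divr_gt0].
have t1 : t <= 1 / 2 by rewrite ge_min lexx.
have t2 : t * K <= e by rewrite -ler_pdivlMr // ge_min lexx orbT.
have := key (1 - t); have -> : 0 < 1 - t < 1 by apply/andP; split; lra.
move=> /(_ isT); rewrite /K in t2; lra.
Qed.

(** Equality case of Schwarz-Pick: the quotient [H] at [r] takes the value 1 at [-r], so it is 1
    throughout by [strong_maximum], and the Moebius transforms of [F z] and [z] agree. *)
Lemma disc_map_rigidity F r : Hol F -> (forall z, cabs z < 1 -> cabs (F z) <= 1) ->
  0 < r < 1 -> F r%:K = r%:K -> F (- r%:K) = - r%:K -> forall z, cabs z < 1 -> F z = z.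
Proof.
move=> hF F1 /andP[r0 r1] Fr Fnr.
have cr : cabs r%:K < 1 by rewrite cabsC gtr0_norm.
have cnr : cabs (- r%:K) < 1 by rewrite cabsN.
have rn0 : r%:K != 0 :> R[i] by rewrite -cabs_gt0 cabsC gtr0_norm.
have [hG G1] := moebius_Hol hF F1 cr.
have [|H [hH H1 HE]] := @schwarz_pick _ r%:K hG G1 cr.
  by rewrite Fr subrr mul0r.
have Hr : H (- r%:K) = 1.
  have n1 : - r%:K - r%:K != 0 :> R[i] by rewrite -opprD oppr_eq0 -mulr2n mulrn_eq0.
  apply: (mulfI n1); rewrite -HE Fnr mulr1 divfK //.
  exact: blaschke_den_neq0 cr (ltW cnr).
move=> z z1; have := HE z; rewrite (strong_maximum hH H1 cnr Hr) // mulr1 conj_real.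
have d1 : 1 - r%:K * F z != 0.
  by have := blaschke_den_neq0 cr (F1 z z1); rewrite conj_real.
have d2 : 1 - r%:K * z != 0.
  by have := blaschke_den_neq0 cr (ltW z1); rewrite conj_real.
move/(congr1 (fun w => w * (1 - r%:K * F z))).
rewrite mulrAC divfK // => E.
have : (1 - r%:K * r%:K) * (F z - z) = 0.
  have -> : (1 - r%:K * r%:K) * (F z - z) =
     (F z - r%:K) * (1 - r%:K * z) - (z - r%:K) * (1 - r%:K * F z) by ring.
  by rewrite E subrr.
move/eqP; rewrite mulf_eq0 subr_eq0 => /orP[|]; last by rewrite subr_eq0 => /eqP.
have := blaschke_den_neq0 cr (ltW cr); rewrite conj_real subr_eq0 => h.
by rewrite (negbTE h).
Qed.

End Schwarz.

(** * Functions unimodular on a circle *)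

Section Blaschke.
Context {R : realType}.
Implicit Types (f g h F : R[i] -> R[i]) (rho r : R) (a z w : R[i]) (s : seq R[i]).

Lemma realC_inj : injective (fun x : R => x%:K).
Proof. by move=> x y [] ->. Qed.

Lemma Hol_eq_cst_near0 f c rho : Hol f -> 0 < rho ->
  (forall z, cabs z < rho -> f z = c) -> forall z, cabs z < 1 -> f z = c.
Proof.
move=> hf rho0 hc z z1; apply/eqP; rewrite -subr_eq0; apply/eqP.
pose t := Num.min (1 / 2) (rho / 2).
have t0 : 0 < t by rewrite lt_min; apply/andP; split; apply: divr_gt0.
have t1 : t < 1 by rewrite gt_min; apply/orP; left; lra.
have t2 : t < rho by rewrite gt_min; apply/orP; right; lra.
apply: (identity_theorem (HolB hf (Hol_cst R c)) t1 _ z1) => n.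
exists [seq (t / k.+1%:R)%:K | k <- iota 0 n]; split.
- rewrite map_inj_uniq ?iota_uniq // => k l /realC_inj.
  have tn0 : t != 0 by rewrite gt_eqF.
  by move=> /(mulfI tn0)/invr_inj/eqP; rewrite eqr_nat => /eqP [].
- by rewrite size_map size_iota.
move=> a /mapP [k _ ->].
have tk : cabs (t / k.+1%:R)%:K <= t.
  by rewrite cabsC ger0_norm ?divr_ge0 ?(ltW t0) // ler_pdivrMr // ler_peMr ?(ltW t0) // ler1n.
by split=> //; rewrite hc ?subrr //; exact: le_lt_trans t2.
Qed.

(** The maximum principle for [h] and [1 / h] gives modulus 1 on the closed disc of radius [r].
    Rescaled to the unit disc, [h / h 0] is constant by [strong_maximum], and the identity theorem
    extends this to the whole disc. *)
Lemma Hol_unimodular_nonzero h r : Hol h -> 0 < r < 1 ->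
  (forall z, cabs z = r -> cabs (h z) = 1) -> (forall z, cabs z <= r -> h z != 0) ->
  exists2 c, cabs c = 1 & forall z, cabs z < 1 -> h z = c.
Proof.
move=> hh r01 hc h0; have /andP[r0 r1] := r01.
have up z : cabs z <= r -> cabs (h z) <= 1.
  by apply: (Hol_max_modulus hh r01) => w /hc ->.
have hV : holc r (fun z => (h z)^-1).
  by move=> z zr; apply: cdiffV; [exact: h0|exact: (Hol_holc hh r1 zr)].
have lo z : cabs z <= r -> 1 <= cabs (h z).
  move=> zr; have : cabs (h z)^-1 <= 1.
    by apply: (max_modulus r0 hV) zr => w wr; rewrite cabsV (hc w wr) invr1.
  by rewrite cabsV invf_le1 // cabs_gt0 h0.
have z0 : cabs (0 : R[i]) <= r by rewrite cabs0 ltW.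
have c1 : cabs (h 0) = 1 by apply/eqP; rewrite eq_le up // lo.
exists (h 0) => //.
have n0 := h0 0 z0.
have cr : cabs r%:K = r by rewrite cabsC gtr0_norm.
have hF : Hol (fun z => (h 0)^-1 * h (r%:K * z)).
  apply: (HolM (Hol_cst R (h 0)^-1)); apply: (Hol_scale hh); rewrite cr; exact: ltW.
have F1 z : cabs z < 1 -> cabs ((h 0)^-1 * h (r%:K * z)) <= 1.
  move=> z1; rewrite cabsM cabsV c1 invr1 mul1r; apply: up.
  by rewrite cabsM cr ler_piMr ?(ltW r0) ?(ltW z1).
have F0 : (h 0)^-1 * h (r%:K * 0) = 1 by rewrite mulr0 mulVf.
have d0 : cabs (0 : R[i]) < 1 by rewrite cabs0.
have sm := strong_maximum hF F1 d0 F0.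
apply: (Hol_eq_cst_near0 hh r0) => z zr.
have rn : r%:K != 0 :> R[i] by rewrite -cabs_gt0 cr.
have := sm (z / r%:K) _; rewrite cabsM cabsV cr ltr_pdivrMr // mul1r => /(_ zr).
rewrite [r%:K * _]mulrC divfK //.
by move=> /(congr1 ( *%R (h 0))); rewrite mulrA divff // mul1r mulr1.
Qed.

(** Replacing each zero factor [z - a] of [g] by the reflected factor [d a z], of equal modulus on
    the circle, gives a function unimodular there and zero-free on the closed disc of radius [r],
    hence a constant. In the variable [z / r] the zeros become [a / r]. *)
Lemma unimodular_blaschke g r : Hol g -> 0 < r < 1 ->
  (forall z, cabs z = r -> cabs (g z) = 1) ->
  exists B, (constant_map B \/ finite_blaschke B) /\
    forall z, cabs z < 1 -> g z = B (z / r%:K).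
Proof.
move=> hg r01 hc; have /andP[r0 r1] := r01.
have cr : cabs r%:K = r by rewrite cabsC gtr0_norm.
have rn : r%:K != 0 :> R[i] by rewrite -cabs_gt0 cr.
have cr1 : cabs r%:K < 1 by rewrite cr.
have gr : g r%:K != 0 by rewrite -cabs_gt0 hc.
have [s [k [hk hs gE k0]]] :=
  @zero_factor _ g r%:K r (fun a => cabs a <= r) hg cr1 gr r1 (fun a ha => ha).
have sr a : a \in s -> cabs a < r.
  move=> as_; rewrite lt_neqAle hs // andbT; apply/eqP => ar.
  have : cabs (g a) = 1 by exact: hc.
  rewrite gE ?ar // (big_rem a as_) /= subrr !mul0r cabs0 => /eqP.
  by rewrite eq_sym oner_eq0.
pose d a z : R[i] := ((r ^+ 2)%:K - a^* * z) / r%:K.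
pose h z := \prod_(a <- s) d a z * k z.
have hd a : Hol (d a).
  have hl := HolB (Hol_cst R (r ^+ 2)%:K) (HolM (Hol_cst R a^*) (Hol_id R)).
  exact: (HolM hl (Hol_cst R (r%:K)^-1)).
have hh : Hol h by exact: (HolM (@Hol_prod _ _ s d hd) hk).
have h1 z : cabs z = r -> cabs (h z) = 1.
  move=> zr; rewrite -(hc z zr) gE ?zr // /h !cabsM !cabs_prod; congr (_ * _).
  apply: eq_bigr => a _; rewrite cabsM cabsV blaschke_circle ?(ltW r0) // cr.
  by rewrite mulrC mulKf // gt_eqF.
have h0 z : cabs z <= r -> h z != 0.
  move=> zr; rewrite mulf_neq0 ?k0 // prodf_seq_neq0; apply/allP => a /sr ar /=.
  rewrite mulf_neq0 ?invr_eq0 // -cabs_gt0.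
  have := cabs_subl (r ^+ 2)%:K (a^* * z); apply: lt_le_trans.
  rewrite cabsC ger0_norm ?exprn_ge0 ?(ltW r0) // subr_gt0 cabsM cabs_conj.
  have : cabs a * cabs z <= cabs a * r by rewrite ler_wpM2l ?cabs_ge0.
  by move/le_lt_trans; apply; rewrite expr2 ltr_pM2r.
have [c c1 hE] := Hol_unimodular_nonzero hh r01 h1 h0.
have cn : c != 0 by rewrite -cabs_gt0 c1.
exists (blaschke c [seq a / r%:K | a <- s]); split; last first.
  move=> z z1; rewrite /blaschke big_map gE // -(hE z z1) /h.
  have dn : \prod_(a <- s) d a z != 0.
    by have := cn; rewrite -(hE z z1) mulf_eq0 negb_or => /andP[].
  rewrite mulrAC -big_split /=; congr (_ * _); apply: eq_big_seq => a as_.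
  have da : d a z != 0 by move: dn; rewrite prodf_seq_neq0 => /allP/(_ a as_).
  have -> : 1 - (a / r%:K)^* * (z / r%:K) = d a z / r%:K.
    by rewrite /d conjM conjV conj_real rmorphXn; field.
  by move: da; set D := d a z => da; field; rewrite da rn.
case: (s =P [::]) => [s0|/eqP s0].
  by left; exists c; apply/funext => z; rewrite /blaschke s0 big_nil mulr1.
right; exists c, [seq a / r%:K | a <- s]; split=> //.
  by rewrite size_map lt0n size_eq0.
move=> x /mapP [a /sr ar ->]; rewrite /disc /= cabsM cabsV cr.
by rewrite ltr_pdivrMr // mul1r.
Qed.

End Blaschke.

(** * Isometries *)

Section Peaks.
Context {R : realType}.
Implicit Types (f g : R[i] -> R[i]) (r : R) (z w : R[i]).

Lemma compact_disc_radius (L : set (R[i] : numFieldType)) : compact L -> L `<=` @disc R ->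
  exists2 rho : R, 0 < rho < 1 & forall z, L z -> cabs z <= rho.
Proof.
move=> cL LD.
have [L0|] := pselect (L !=set0); last first.
  by move=> L0; exists (1 / 2); [lra|move=> z Lz; exfalso; apply: L0; exists z].
have ct : continuous (@cabs R : (R[i] : numFieldType) -> R).
  move=> z A /nbhs_ballP [e /= e0 eA].
  have e0C : 0 < e%:K :> R[i] by rewrite ltcR.
  apply/nbhs_ballP; exists e%:K => // w; rewrite /ball /= normE ltcR => zw.
  apply: eA; rewrite /ball /=; apply: le_lt_trans zw.
  have h1 := cabs_subl z w; have h2 := cabs_subl w z; rewrite cabs_distC in h2.
  by rewrite ler_norml; lra.
have [c cL' hc] := compact_EVT_max L0 cL (continuous_subspaceT ct).
have c1 : cabs c < 1 by apply: LD; rewrite -in_setE.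
exists ((1 + cabs c) / 2); first by have := cabs_ge0 c; lra.
move=> z Lz; have := hc z; rewrite in_setE => /(_ Lz); lra.
Qed.

(** By the maximum principle the supremum over the disc is the maximum over the circle. *)
Lemma supnorm_attained r f : 0 < r < 1 -> Hol f ->
  exists z, [/\ cabs z <= r, cabs (f z) = supnorm_r r f &
                forall w, cabs w <= r -> cabs (f w) <= supnorm_r r f].
Proof.
move=> r01 hf; have /andP[r0 r1] := r01.
have [z zr hM] := circle_bound (ltW r0) (Hol_holc hf r1).
have hm w : cabs w <= r -> cabs (f w) <= cabs (f z).
  by apply: (Hol_max_modulus hf r01) => v; exact: hM.
have zr' : cabs z <= r by rewrite zr.
have E : cabs (f z) = supnorm_r r f.
  apply/eqP; rewrite eq_le; apply/andP; split.
    apply: ub_le_sup; last by exists z.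
    by exists (cabs (f z)) => _ [w /hm wr <-].
  apply: ge_sup; first by exists (cabs (f z)), z.
  by move=> _ [w /hm wr <-].
by exists z; split=> // w /hm; rewrite E.
Qed.

(** The squared mutual distances and [|a + b + c|^2] add up to three times the sum of the squared
    moduli, which is at most 9; so the distances vanish. *)
Lemma three_units_eq (a b c : R[i]) : cabs a <= 1 -> cabs b <= 1 -> cabs c <= 1 ->
  cabs (a + b + c) = 3 -> [/\ cabs a = 1, b = a & c = a].
Proof.
move=> a1 b1 c1 h.
have sq w : cabs w <= 1 -> cabs w ^+ 2 <= 1 by move=> w1; rewrite exprn_ile1 ?cabs_ge0.
have P : cabs (b - a) ^+ 2 + cabs (c - a) ^+ 2 + cabs (b - c) ^+ 2 + cabs (a + b + c) ^+ 2 =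
    3 * (cabs a ^+ 2 + cabs b ^+ 2 + cabs c ^+ 2).
  by rewrite !cabs_sqr; case: a {a1 h} => ? ?; case: b {b1} => ? ?; case: c {c1} => ? ? /=; ring.
rewrite h in P; move: (sq a a1) (sq b b1) (sq c c1) => a2 b2 c2.
have n1 := exprn_ge0 2 (cabs_ge0 (b - a)); have n2 := exprn_ge0 2 (cabs_ge0 (c - a)).
have n3 := exprn_ge0 2 (cabs_ge0 (b - c)).
have z1 : cabs (b - a) ^+ 2 == 0 by apply/eqP; lra.
have z2 : cabs (c - a) ^+ 2 == 0 by apply/eqP; lra.
move: z1 z2; rewrite !expf_eq0 /= !cabs_eq0 !subr_eq0 => /eqP -> /eqP ->; split=> //.
apply/eqP; rewrite eq_le a1 /=.
have := cabsD (a + b) c; have := cabsD a b; lra.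
Qed.

Lemma distinct_units n : exists s : seq R[i],
  [/\ uniq s, size s = n & forall l, l \in s -> cabs l = 1].
Proof.
pose p (k : nat) : R[i] := ((k.+1%:R)^-1 +i* Num.sqrt (1 - (k.+1%:R)^-1 ^+ 2))%C.
exists [seq p k | k <- iota 0 n]; split.
- rewrite map_inj_uniq ?iota_uniq // => k l [] /invr_inj/eqP.
  by rewrite eqr_nat => /eqP [].
- by rewrite size_map size_iota.
move=> l /mapP [k _ ->]; rewrite /p /cabs /= sqr_sqrtr.
  by rewrite subrKC sqrtr1.
by rewrite subr_ge0 exprn_ile1 ?invr_ge0 // invf_le1 ?ler1n ?ltr0n.
Qed.

Lemma Hol_polynomial n (c : nat -> R[i]) : Hol (fun w => \sum_(k < n) c k * w ^+ k).
Proof.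
elim: n => [|n IH].
  have -> : (fun w => \sum_(k < 0) c k * w ^+ k) = (fun=> 0).
    by apply/funext => w; rewrite big_ord0.
  exact: (Hol_cst R 0).
have -> : (fun w => \sum_(k < n.+1) c k * w ^+ k) =
    (fun w => \sum_(k < n) c k * w ^+ k + c n * w ^+ n).
  by apply/funext => w; rewrite big_ord_recr.
exact: (HolD IH (HolM (Hol_cst R (c n)) (@HolX _ _ n (Hol_id R)))).
Qed.

End Peaks.

(** * Images of the monomials and the form of the operator *)

Section Isometry.
Context {R : realType}.
Variables (r : R) (T : (R[i] -> R[i]) -> (R[i] -> R[i])).

Hypotheses (hr : 0 < r < 1) (T_hol : forall f, Hol f -> Hol (T f))
  (T_lin : forall (a b : R[i]) f g, Hol f -> Hol g ->
     forall z, @disc R z -> T (fun w => a * f w + b * g w) z = a * T f z + b * T g z)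
  (T_cont : hol_continuous T)
  (T_iso : forall f, Hol f -> supnorm_r r (T f) = supnorm_r r f).

Let e (n : nat) (z : R[i]) := z ^+ n.
Let g n := T (e n).

Let r0 : 0 < r. Proof. by case/andP: hr. Qed.
Let r1 : r < 1. Proof. by case/andP: hr. Qed.
Let cr : cabs r%:K = r. Proof. by rewrite cabsC gtr0_norm. Qed.
Let rn : r%:K != 0 :> R[i]. Proof. by rewrite -cabs_gt0 cr. Qed.

Let e_hol n : Hol (e n). Proof. exact: (@HolX _ _ n (Hol_id R)). Qed.
Let g_hol n : Hol (g n). Proof. exact (T_hol (@e_hol n)). Qed.
Let r_disc z : cabs z <= r -> cabs z < 1. Proof. by move=> h; exact: le_lt_trans r1. Qed.

Lemma image_monomial_le n z : cabs z <= r -> cabs (g n z) <= r ^+ n.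
Proof.
move=> zr; have [w [wr wE _]] := supnorm_attained hr (@e_hol n).
have [_ [_ _ h]] := supnorm_attained hr (@g_hol n).
apply: (le_trans (h z zr)); rewrite /g T_iso // -wE /e cabsX.
by rewrite lerXn2r ?nnegrE ?cabs_ge0 ?(ltW r0).
Qed.

(* The test function 1 + w + w^n with w = z / (r l) has norm 3, attained at r l, so
   its image has modulus 3 somewhere: the three summands then agree there. *)
Lemma peak_point l n : cabs l = 1 -> exists z, [/\ cabs z <= r, cabs (g 0 z) = 1,
  g 1 z = r%:K * l * g 0 z & g n z = (r%:K * l) ^+ n * g 0 z].
Proof.
move=> l1; pose q := (r%:K * l)^-1.
have ln : l != 0 by rewrite -cabs_gt0 l1.
have qn : q != 0 by rewrite invr_eq0 mulf_neq0.
have cq : cabs q = r^-1 by rewrite cabsV cabsM cr l1 mulr1.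
(* The three-term function is built from two binary combinations, the form to which [T_lin]
   applies. *)
pose F1 w := 1 * e 0 w + q * e 1 w.
pose F w := 1 * F1 w + q ^+ n * e n w.
have hF1 : Hol F1 by exact: (HolD (HolM (Hol_cst R 1) (@e_hol 0)) (HolM (Hol_cst R q) (@e_hol 1))).
have hF : Hol F by exact: (HolD (HolM (Hol_cst R 1) hF1) (HolM (Hol_cst R (q ^+ n)) (@e_hol n))).
have FE w : F w = 1 + q * w + (q * w) ^+ n by rewrite /F /F1 /e exprMn expr0 expr1 !mul1r.
have qw w : cabs w <= r -> cabs (q * w) <= 1.
  by move=> wr; rewrite cabsM cq mulrC ler_pdivrMr // mul1r.
have F3 w : cabs w <= r -> cabs (F w) <= 3.
  move=> wr; rewrite FE; have h := qw w wr.
  have h1 := cabsD (1 + q * w) ((q * w) ^+ n); have h2 := cabsD 1 (q * w).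
  have h3 : cabs ((q * w) ^+ n) <= 1 by rewrite cabsX exprn_ile1 ?cabs_ge0.
  by rewrite cabs1 in h2; lra.
have sF : supnorm_r r F = 3.
  have [w [wr wE wm]] := supnorm_attained hr hF.
  apply/eqP; rewrite eq_le -{1}wE F3 //=.
  have := wm (r%:K * l); rewrite FE mulVf ?mulf_neq0 // expr1n cabsM cr l1 mulr1.
  have -> : cabs (1 + 1 + 1 : R[i]) = 3.
    by rewrite -(rmorph1 (real_complex R)) -!rmorphD cabsC ger0_norm //; lra.
  by apply.
have [z [zr zE _]] := supnorm_attained hr (T_hol hF).
rewrite T_iso // sF in zE.
have zd : disc z by exact: r_disc.
have TE : T F z = g 0 z + q * g 1 z + q ^+ n * g n z.
  by rewrite /F (T_lin _ _ hF1 (@e_hol n)) // {1}/F1 (T_lin _ _ (@e_hol 0) (@e_hol 1)) // !mul1r.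
have gq k : cabs (q ^+ k * g k z) <= 1.
  rewrite cabsM cabsX cq exprVn mulrC ler_pdivrMr ?exprn_gt0 // mul1r.
  exact: image_monomial_le.
have g0le : cabs (g 0 z) <= 1 by have := gq 0%N; rewrite expr0 mul1r.
have g1le : cabs (q * g 1 z) <= 1 by have := gq 1%N; rewrite expr1.
rewrite TE in zE; have [u1 u2 u3] := three_units_eq g0le g1le (gq n) zE.
exists z; split=> //.
  by rewrite -u2 /q mulrA divff ?mul1r // mulf_neq0.
by rewrite -u3 mulrA -exprMn divff ?expr1n ?mul1r // mulf_neq0.
Qed.

(** At a peak point for [l] the quotient [g 1 / g 0] equals [r l], so different [l] give different
    points, and [h] has arbitrarily many zeros in [|z| <= r]. *)
Lemma vanish_on_peaks h : Hol h ->
  (forall l, cabs l = 1 -> exists z, [/\ cabs z <= r, cabs (g 0 z) = 1,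
     g 1 z = r%:K * l * g 0 z & h z = 0]) ->
  forall z, cabs z < 1 -> h z = 0.
Proof.
move=> hh H.
have /choice [p hp] : forall l, exists z, cabs l = 1 -> [/\ cabs z <= r, cabs (g 0 z) = 1,
     g 1 z = r%:K * l * g 0 z & h z = 0].
  move=> l; have [/eqP l1|l1] := boolP (cabs l == 1).
    by have [z hz] := H l l1; exists z.
  by exists 0 => l1'; rewrite l1' eqxx in l1.
apply: (identity_theorem hh r1) => n.
have [s [us sn hs]] := distinct_units (R := R) n.
exists [seq p l | l <- s]; split; last first.
- by move=> a /mapP [l /hs/hp [? _ _ ?] ->].
- by rewrite size_map.
rewrite map_inj_in_uniq // => l l' /hs/hp [_ l1 l2 _] /hs/hp [_ l1' l2' _] E.
rewrite -E l2 in l2'.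
have gn : g 0 (p l) != 0 by rewrite -cabs_gt0 l1.
exact: (mulfI rn (mulIf gn l2')).
Qed.

(** At a peak point both sides are the power [n + 1] of [r l g 0 z]. Free of division, the identity
    makes sense at zeros of [g 0] too. *)
Lemma image_monomial_power n z : cabs z < 1 -> g n.+1 z * g 0 z ^+ n = g 1 z ^+ n.+1.
Proof.
move=> z1; apply/eqP; rewrite -subr_eq0; apply/eqP; move: z z1.
apply: vanish_on_peaks.
  exact: (HolB (HolM (@g_hol n.+1) (@HolX _ _ n (@g_hol 0))) (@HolX _ _ n.+1 (@g_hol 1))).
move=> l l1; have [z [zr z1 z2 z3]] := peak_point n.+1 l1.
by exists z; split=> //; rewrite z2 z3 [(_ * g 0 z) ^+ _]exprMn -mulrA -exprS subrr.
Qed.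

Lemma image_polynomial n (c : nat -> R[i]) z : cabs z < 1 ->
  T (fun w => \sum_(k < n) c k * w ^+ k) z = \sum_(k < n) c k * g k z.
Proof.
move=> z1; elim: n => [|n IH].
  rewrite big_ord0.
  have -> : (fun w => \sum_(k < 0) c k * w ^+ k) = (fun w => 0 * e 0 w + 0 * e 0 w).
    by apply/funext => w; rewrite big_ord0 !mul0r addr0.
  by rewrite (T_lin _ _ (@e_hol 0) (@e_hol 0)) // !mul0r addr0.
have -> : (fun w => \sum_(k < n.+1) c k * w ^+ k) =
    (fun w => 1 * (\sum_(k < n) c k * w ^+ k) + c n * e n w).
  by apply/funext => w; rewrite big_ord_recr /= mul1r.
by rewrite (T_lin _ _ (@Hol_polynomial _ n c) (@e_hol n)) // IH mul1r big_ord_recr.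
Qed.

(** Continuity at [f] for the compact set reduced to [z], specialised to polynomials, whose images
    are explicit, and with [L] enlarged to a closed disc. *)
Lemma image_continuity f z eps : Hol f -> cabs z < 1 -> 0 < eps ->
  exists rho dl : R, [/\ 0 < rho < 1, 0 < dl &
    forall n (c : nat -> R[i]),
      (forall w, cabs w <= rho -> cabs (\sum_(k < n) c k * w ^+ k - f w) <= dl) ->
      cabs (\sum_(k < n) c k * g k z - T f z) <= eps].
Proof.
move=> hf z1 eps0.
have zD : [set z] `<=` @disc R by move=> _ ->.
have [L [dl [cL LD dl0 H]]] := T_cont hf (compact_set1 (x := z : (R[i] : numFieldType))) zD eps0.
have [rho rho1 hrho] := compact_disc_radius cL LD.
exists rho, dl; split=> // n c hc.
rewrite -(@image_polynomial n c z z1); apply: (H _ (@Hol_polynomial _ n c)) => //.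
by move=> w /hrho; exact: hc.
Qed.

(* If |w| > 1 for w = g 1 z / g 0 z, the partial sums of the geometric series
   1 / (1 - u / w) converge in Hol, but T sends the n-th one to n * g 0 z at z. *)
Lemma image_id_le z : cabs z < 1 -> cabs (g 1 z) <= cabs (g 0 z).
Proof.
move=> z1; have [g00|g00] := eqVneq (g 0 z) 0.
  (* At a zero of [g 0] the identity for [n = 1] reads [g 1 z ^ 2 = 0]. *)
  have := image_monomial_power 1 z1; rewrite g00 expr1 mulr0 => /esym/eqP.
  by rewrite expf_eq0 /= => /eqP ->.
rewrite leNgt; apply/negP => lt.
have G0 : 0 < cabs (g 0 z) by rewrite cabs_gt0.
set w := g 1 z / g 0 z.
have w1 : 1 < cabs w by rewrite cabsM cabsV ltr_pdivlMr // mul1r.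
have wn : w != 0 by rewrite -cabs_gt0; apply: lt_trans w1.
have gw k : g k z = g 0 z * w ^+ k.
  case: k => [|k]; first by rewrite expr0 mulr1.
  apply: (mulIf (expf_neq0 k g00)); rewrite image_monomial_power // /w expr_div_n.
  by rewrite [g 0 z ^+ k.+1]exprS; field; rewrite g00 expf_neq0.
have vle u : cabs (u / w) <= cabs u.
  by rewrite cabsM cabsV ler_piMr ?cabs_ge0 // invf_le1 ?(ltW w1) //; apply: lt_trans w1.
have den u : cabs u < 1 -> 1 - cabs u <= cabs (1 - u / w).
  by move=> u1; have := cabs_subl 1 (u / w); rewrite cabs1; have := vle u; lra.
have hf : Hol (fun u => (1 - u / w)^-1).
  apply: (HolV (HolB (Hol_cst R 1) (HolM (Hol_id R) (Hol_cst R w^-1)))) => u u1.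
  by rewrite -cabs_gt0; apply: lt_le_trans (den u u1); rewrite subr_gt0.
have [rho [dl [/andP[rho0 rho1] dl0 H]]] := image_continuity hf z1 ltr01.
have [n0 hn0] : exists n, rho ^+ n < dl * (1 - rho).
  by apply: geometric_small; rewrite ?(ltW rho0) // mulr_gt0 // subr_gt0.
have near n : (n0 <= n)%N -> cabs (n%:R * g 0 z - T (fun u => (1 - u / w)^-1) z) <= 1.
  move=> nn; have -> : n%:R * g 0 z = \sum_(k < n) (w^-1) ^+ k * g k z.
    have -> : \sum_(k < n) (w^-1) ^+ k * g k z = \sum_(k < n) g 0 z.
      apply: eq_bigr => k _; rewrite gw mulrCA exprVn mulVf ?mulr1 //.
      exact: expf_neq0.
    by rewrite sumr_const card_ord mulr_natl.
  apply: (H n (fun k => w^-1 ^+ k)) => u ur.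
  have u1 : cabs u < 1 by exact: le_lt_trans rho1.
  have dn : 0 < cabs (1 - u / w) by apply: lt_le_trans (den u u1); rewrite subr_gt0.
  have -> : \sum_(k < n) w^-1 ^+ k * u ^+ k = \sum_(k < n) (u / w) ^+ k.
    by apply: eq_bigr => k _; rewrite -exprMn mulrC.
  rewrite [(1 - u / w)^-1](@geo_kernel _ _ n); last by rewrite -cabs_gt0.
  rewrite opprD addrA subrr add0r cabsN cabsM cabsV cabsX ler_pdivrMr //.
  have h1 : cabs (u / w) ^+ n <= rho ^+ n0.
    apply: (@le_trans _ _ (rho ^+ n)); last by apply: ler_wiXn2l => //; exact: ltW.
    by apply: lerXn2r; rewrite ?nnegrE ?cabs_ge0 ?(ltW rho0) // (le_trans (vle u)).
  have h2 : dl * (1 - rho) <= dl * cabs (1 - u / w).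
    by apply: ler_wpM2l; [exact: ltW|apply: le_trans (den u u1); lra].
  lra.
(* The images of the sums with [n0] and [n0 + m] terms are within 1 of the same value, yet differ by
   [m] times [g 0 z], of modulus more than 2. *)
pose m := Num.bound (2 / cabs (g 0 z)).
have hm : 2 / cabs (g 0 z) < m%:R by apply: archi_boundP; rewrite divr_ge0 // cabs_ge0.
have h1 := near n0 (leqnn _); have h2 := near (n0 + m)%N (leq_addr _ _).
set t := T _ z in h1 h2.
have : cabs (m%:R * g 0 z) <= 2.
  have -> : m%:R * g 0 z = ((n0 + m)%:R * g 0 z - t) - (n0%:R * g 0 z - t) by rewrite natrD; ring.
  by apply: (le_trans (cabsB _ _)); lra.
move: hm; rewrite ltr_pdivrMr // cabsM.
have -> : cabs (m%:R : R[i]) = m%:R by rewrite -(rmorph_nat (real_complex R)) cabsC normr_nat.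
by move=> /lt_le_trans h /h; rewrite ltxx.
Qed.

(** The hypothesis says that [z] and [w] are at least as far apart, in pseudo-hyperbolic distance,
    as [r] and [-r]. Squared, it yields [|z - w| >= 2 r]; the parallelogram law with [|z|, |w| <= r]
    then forces [z + w = 0]. *)
Lemma antipodal_peaks z w : cabs z <= r -> cabs w <= r ->
  2 * r * cabs (1 - w^* * z) <= cabs (z - w) * (1 + r ^+ 2) -> z = - w /\ cabs w = r.
Proof.
move=> zr wr h; have r0' := r0; have r1' := r1.
have z2 : cabs z ^+ 2 <= r ^+ 2 by apply: lerXn2r; rewrite ?nnegrE ?cabs_ge0 ?(ltW r0).
have w2 : cabs w ^+ 2 <= r ^+ 2 by apply: lerXn2r; rewrite ?nnegrE ?cabs_ge0 ?(ltW r0).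
have rr : r ^+ 2 < 1 by rewrite exprn_ilt1 ?(ltW r0).
have rr0 : 0 <= r ^+ 2 := exprn_ge0 2 (ltW r0).
set D := cabs (z - w) in h; have D0 : 0 <= D := cabs_ge0 _.
have E : cabs (1 - w^* * z) ^+ 2 = D ^+ 2 + (1 - cabs w ^+ 2) * (1 - cabs z ^+ 2).
  by have := blaschke_identity w z 1; rewrite expr1n mul1r -/D => <-; ring.
have low : D ^+ 2 + (1 - r ^+ 2) ^+ 2 <= cabs (1 - w^* * z) ^+ 2.
  by rewrite E lerD2l [leLHS]expr2; apply: ler_pM; lra.
have h2 : 4 * r ^+ 2 * cabs (1 - w^* * z) ^+ 2 <= D ^+ 2 * (1 + r ^+ 2) ^+ 2.
  have -> : 4 * r ^+ 2 * cabs (1 - w^* * z) ^+ 2 = (2 * r * cabs (1 - w^* * z)) ^+ 2 by ring.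
  rewrite -exprMn; apply: lerXn2r => //; rewrite nnegrE.
    by rewrite !mulr_ge0 ?cabs_ge0 ?(ltW r0).
  by apply: mulr_ge0 => //; lra.
have h3 : 4 * r ^+ 2 * (D ^+ 2 + (1 - r ^+ 2) ^+ 2) <= D ^+ 2 * (1 + r ^+ 2) ^+ 2.
  by apply: le_trans h2; apply: ler_wpM2l => //; rewrite mulr_ge0 // exprn_ge0 // ltW.
have h4 : 4 * r ^+ 2 <= D ^+ 2.
  have p : 0 < (1 - r ^+ 2) ^+ 2 by rewrite exprn_gt0 // subr_gt0.
  rewrite -(ler_pM2r p) -subr_ge0.
  have -> : D ^+ 2 * (1 - r ^+ 2) ^+ 2 - 4 * r ^+ 2 * (1 - r ^+ 2) ^+ 2 =
    D ^+ 2 * (1 + r ^+ 2) ^+ 2 - 4 * r ^+ 2 * (D ^+ 2 + (1 - r ^+ 2) ^+ 2) by ring.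
  by rewrite subr_ge0.
have P : cabs (z + w) ^+ 2 + D ^+ 2 = 2 * (cabs z ^+ 2 + cabs w ^+ 2).
  by rewrite /D !cabs_sqr; case: (z) => ? ?; case: (w) => ? ? /=; ring.
have s0 := exprn_ge0 2 (cabs_ge0 (z + w)).
have : cabs (z + w) ^+ 2 == 0 by apply/eqP; lra.
rewrite expf_eq0 /= cabs_eq0 addr_eq0 => /eqP ->; split=> //.
apply/eqP; rewrite eq_le wr /= -(@ler_pXn2r _ 2) ?nnegrE ?cabs_ge0 ?(ltW r0) //; lra.
Qed.

Lemma image_id_rotation : exists2 beta : R[i], cabs beta = 1 &
  forall z, cabs z < 1 -> g 1 z = g 0 z * (beta * z).
Proof.
have [zp [zpr g0p g1p _]] := peak_point 0 (cabs1 : cabs (1 : R[i]) = 1).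
have n1 : cabs (-1 : R[i]) = 1 by rewrite cabsN cabs1.
have [zm [zmr g0m g1m _]] := peak_point 0 n1.
have gp : g 0 zp != 0 by rewrite -cabs_gt0 g0p.
have gm : g 0 zm != 0 by rewrite -cabs_gt0 g0m.
have zp1 := r_disc zpr; have zm1 := r_disc zmr.
have [phi [hphi phiE phi1]] := Hol_quotient (@g_hol 0) (@g_hol 1) zp1 gp image_id_le.
have pp : phi zp = r%:K by apply: (mulfI gp); rewrite -phiE // g1p mulr1 mulrC.
have pm : phi zm = - r%:K by apply: (mulfI gm); rewrite -phiE // g1m mulrN1 mulrC.
have [zmE zpE] : zm = - zp /\ cabs zp = r.
  apply: antipodal_peaks => //.
  have pp1 : cabs (phi zp) < 1 by rewrite pp cr.
  have := schwarz_pick_pair hphi phi1 zp1 zm1 pp1.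
  rewrite pp pm conj_real mulrN opprK -opprD cabsN.
  have -> : cabs (r%:K + r%:K) = 2 * r.
    rewrite -rmorphD cabsC ger0_norm; first by ring.
    by apply: addr_ge0; exact: ltW.
  have -> // : cabs (1 + r%:K * r%:K) = 1 + r ^+ 2.
  rewrite -(rmorph1 (real_complex R)) -rmorphM -rmorphD cabsC ger0_norm ?expr2 //.
  by apply: addr_ge0 => //; apply: mulr_ge0; exact: ltW.
have zpn : zp != 0 by rewrite -cabs_gt0 zpE.
(* The rotation by [w] takes [r] to [zp] and [-r] to [zm], so [phi (w z)] fixes [r] and [-r] and is
   the identity. *)
pose w := zp / r%:K.
have w1 : cabs w = 1 by rewrite cabsM cabsV cr zpE divff // gt_eqF.
have wn : w != 0 by rewrite -cabs_gt0 w1.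
have w1' : cabs w <= 1 by rewrite w1.
have hpsi := Hol_scale hphi w1'.
have psi1 z : cabs z < 1 -> cabs (phi (w * z)) <= 1.
  by move=> z1; apply: phi1; rewrite cabsM w1 mul1r.
have psir : phi (w * r%:K) = r%:K by rewrite /w divfK.
have psinr : phi (w * - r%:K) = - r%:K by rewrite mulrN /w divfK // -zmE.
have rig := disc_map_rigidity hpsi psi1 hr psir psinr.
exists w^-1; first by rewrite cabsV w1 invr1.
move=> z z1; rewrite phiE //; congr (_ * _).
have := rig (w^-1 * z); rewrite mulrA divff // mul1r; apply.
by rewrite cabsM cabsV w1 invr1 mul1r.
Qed.

Lemma image_formula : exists2 beta : R[i], cabs beta = 1 &
  [/\ forall z, cabs z = r -> cabs (g 0 z) = 1 &
      forall f, Hol f -> forall z, cabs z < 1 -> T f z = g 0 z * f (beta * z)].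
Proof.
have [beta b1 hb] := image_id_rotation.
have bn : beta != 0 by rewrite -cabs_gt0 b1.
have at_peak l z : cabs z <= r -> cabs (g 0 z) = 1 -> g 1 z = r%:K * l * g 0 z ->
    beta * z = r%:K * l.
  move=> zr g0z g1z; have gn : g 0 z != 0 by rewrite -cabs_gt0 g0z.
  by apply: (mulfI gn); rewrite -hb ?r_disc // g1z mulrC.
exists beta => //; split=> [z zr|f hf z z1].
  (* Every point of the circle is a peak point: for [l = beta z / r] the peak [w] satisfies
     [beta w = r l = beta z]. *)
  have l1 : cabs (beta * z / r%:K) = 1.
    by rewrite !cabsM b1 cabsV cr zr mul1r divff // gt_eqF.
  have [w [wr g0w g1w _]] := peak_point 0 l1.
  have := at_peak _ w wr g0w g1w; rewrite mulrCA divff // mulr1.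
  by move/(mulfI bn) <-.
(* Both sides agree at the peak points, where [beta u = r l]. *)
have gE k : forall u, cabs u < 1 -> g k u = g 0 u * (beta * u) ^+ k.
  move=> u u1; apply/eqP; rewrite -subr_eq0; apply/eqP; move: u u1.
  apply: vanish_on_peaks.
    have hbu : Hol (fun u => (beta * u) ^+ k).
      exact: (@HolX _ _ k (HolM (Hol_cst R beta) (Hol_id R))).
    exact: (HolB (@g_hol k) (HolM (@g_hol 0) hbu)).
  move=> l l1; have [u [ur u1 u2 u3]] := peak_point k l1.
  by exists u; split=> //; rewrite u3 (at_peak l u ur u1 u2) mulrC subrr.
apply/eqP; rewrite -subr_eq0; apply/eqP.
apply: (@cabs_small_eq0 _ _ (1 + cabs (g 0 z))) => e0 e00.
have [rho [dl [/andP[rho0 rho1] dl0 H]]] := image_continuity hf z1 e00.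
(* The disc of radius [rh] contains [z], [beta z] and the disc of the continuity estimate; the
   Taylor polynomials taken on the larger circle of radius [rh'] converge to [f] uniformly on it. *)
pose rh := Num.max rho (cabs z); pose rh' := (1 + rh) / 2.
have rh1 : rh < 1 by rewrite gt_max rho1.
have rhr : rho <= rh by rewrite le_max lexx.
have rhz : cabs z <= rh by rewrite le_max lexx orbT.
have rh0 : 0 < rh by exact: lt_le_trans rhr.
have q0 : 0 < rh' by rewrite /rh'; lra.
have q1 : rh' < 1 by rewrite /rh'; lra.
have q2 : rh < rh' by rewrite /rh'; lra.
have [u0 _ hM] := circle_bound (ltW q0) (Hol_holc hf q1).
set M := cabs (f u0) in hM; have M0 : 0 <= M := cabs_ge0 _.
pose q := rh / rh'.
have qq : 0 < q < 1 by rewrite divr_gt0 //= ltr_pdivrMr // mul1r.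
have /andP[qq0 qq1] := qq.
pose ep := Num.min dl e0; have ep0 : 0 < ep by rewrite lt_min dl0.
have K0 : 0 < (M + 1) / (1 - q) by apply: divr_gt0; lra.
have [n hn] : exists n, q ^+ n < ep / ((M + 1) / (1 - q)).
  by apply: geometric_small; rewrite ?(ltW qq0) ?qq1 // divr_gt0.
pose c k := tcoef f rh' k.
have app u : cabs u <= rh -> cabs (\sum_(k < n) c k * u ^+ k - f u) <= ep.
  move=> ur; have uq : cabs u < rh' by exact: le_lt_trans q2.
  rewrite cabs_distC; apply: (le_trans (taylor_bound n q0 uq (Hol_holc hf q1) hM)).
  have uq1 : cabs u / rh' <= q by rewrite ler_pM2r ?invr_gt0.
  have uq0 : 0 <= cabs u / rh' by rewrite divr_ge0 ?cabs_ge0 // ltW.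
  apply: (@le_trans _ _ ((M + 1) * q ^+ n / (1 - q))).
    apply: ler_pM; first by rewrite mulr_ge0 ?exprn_ge0.
    - by rewrite invr_ge0; lra.
    - apply: ler_pM => //; [exact: exprn_ge0|lra|].
      by apply: lerXn2r; rewrite ?nnegrE // ltW.
    - by rewrite lef_pV2 ?posrE; lra.
  have -> : (M + 1) * q ^+ n / (1 - q) = q ^+ n * ((M + 1) / (1 - q)) by ring.
  by rewrite -ler_pdivlMr // ltW.
have hT : cabs (\sum_(k < n) c k * g k z - T f z) <= e0.
  apply: H => u ur; have := app u (le_trans ur rhr).
  by move/le_trans; apply; rewrite ge_min lexx.
have E : \sum_(k < n) c k * g k z = g 0 z * \sum_(k < n) c k * (beta * z) ^+ k.
  by rewrite mulr_sumr; apply: eq_bigr => k _; rewrite gE // mulrCA.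
have hb2 : cabs (\sum_(k < n) c k * (beta * z) ^+ k - f (beta * z)) <= e0.
  have bz : cabs (beta * z) <= rh by rewrite cabsM b1 mul1r.
  by apply: (le_trans (app _ bz)); rewrite ge_min lexx orbT.
have -> : T f z - g 0 z * f (beta * z) = - (\sum_(k < n) c k * g k z - T f z) +
    g 0 z * (\sum_(k < n) c k * (beta * z) ^+ k - f (beta * z)).
  by rewrite E; ring.
apply: (le_trans (cabsD _ _)); rewrite cabsN cabsM.
have := ler_wpM2l (cabs_ge0 (g 0 z)) hb2; lra.
Qed.

End Isometry.

(** The multiplier is the image of the constant 1, written as [z ^+ 0]; it is unimodular on
    [|z| = r], so [unimodular_blaschke] gives it the required form. *)
Theorem theorem4p2 (R : realType) (r : R) (T : (R[i] -> R[i]) -> (R[i] -> R[i]))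
  (hr : 0 < r < 1)
  (T_hol : forall f, Hol f -> Hol (T f))
  (T_ext : forall f g, Hol f -> Hol g -> (forall z, @disc R z -> f z = g z) ->
             forall z, @disc R z -> T f z = T g z)
  (T_lin : forall (a b : R[i]) f g, Hol f -> Hol g ->
             forall z, @disc R z -> T (fun w => a * f w + b * g w) z = a * T f z + b * T g z)
  (T_cont : hol_continuous T)
  (T_iso : forall f, Hol f -> supnorm_r r (T f) = supnorm_r r f) :
  exists (B1 : R[i] -> R[i]) (beta : R[i]),
    [/\ constant_map B1 \/ finite_blaschke B1, cabs beta = 1 &
      forall f, Hol f -> forall z, @disc R z -> T f z = B1 (z / (r%:C)%C) * f (beta * z)].
Proof.
have [beta b1 [g0u TE]] := image_formula hr T_hol T_lin T_cont T_iso.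
have e0 : Hol (fun z : R[i] => z ^+ 0) by exact: (@HolX _ _ 0 (Hol_id R)).
have [B [hB BE]] := unimodular_blaschke (T_hol _ e0) hr g0u.
exists B, beta; split=> // f hf z z1.
by rewrite TE // BE.
Qed.
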